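(* Let $T>0$ and let $b:[0,T]\times\mathbb{R}\to\mathbb{R}$, $\sigma:\mathbb{R}\to\mathbb{R}$ be measurable such that: (i) there exist $K>0$, $p_0>2$ and $p_1>2$ such that for all $x,y\in\mathbb{R}$ and $s\in[0,T]$, $$2xb(s,x)+(p_0-1)|\sigma(x)|^2\le K(1+|x|^2),$$ $$2(x-y)(b(s,x)-b(s,y))+(p_1-1)|\sigma(x)-\sigma(y)|^2\le K|x-y|^2;$$ (ii) there exist $K>0$ and $\ell\in(0,\frac{p_0-2}4]$ such that for all $x,y\in\mathbb{R}$ and $s\in[0,T]$, $$|b(s,x)-b(s,y)|\le K(1+|x|^\ell+|y|^\ell)|x-y|,\qquad|b(s,x)|\le K(1+|x|^{\ell+1}).$$ Let $X$ be the solution of $X_t=x+\int_0^tb(s,X_s)\,\mathrm{d}s+\int_0^t\sigma(X_s)\,\mathrm{d}W_s$, $t\in[0,T]$, $x\in\mathbb{R}$. Then for every $t\in(0,T]$, $X_t$ admits a probability density function on the set $\{x\in\mathbb{R}:\sigma(x)\neq0\}$.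
   Context: $W$ is a one-dimensional standard Brownian motion. Under (i) and (ii) the SDE has a unique strong solution. ''$X_t$ admits a probability density function on a Borel set $B$'' means that the restriction to $B$ of the law of $X_t$ is absolutely continuous with respect to Lebesgue measure. *)

(* Defs.v *)
From HB Require Import structures.
From mathcomp Require Import all_boot all_order all_algebra.
From mathcomp Require Import all_classical all_reals all_analysis.

Set Implicit Arguments.
Unset Strict Implicit.
Unset Printing Implicit Defensive.

Import Order.TTheory GRing.Theory Num.Theory.
Import numFieldNormedType.Exports.

Local Open Scope classical_set_scope.
Local Open Scope ring_scope.

(* A process is a function R -> Omega -> R; only its values at times in
   [0, T] matter, and every condition below is restricted to those times.
   Filtrations are not assumed to satisfy the usual conditions, and path
   properties are only required almost surely. *)

Section stochastic_integral.
Context {R : realType} {d : measure_display} {Omega : measurableType d}.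
Implicit Types (P : probability Omega R) (F : R -> set (set Omega)).
Implicit Types (W X H I : R -> Omega -> R) (T : R).

Definition filtration T F : Prop :=
  [/\ forall t : R, 0 <= t <= T -> sigma_algebra [set: Omega] (F t),
      forall t : R, 0 <= t <= T -> F t `<=` measurable
    & forall s t : R, 0 <= s -> s <= t -> t <= T -> F s `<=` F t].

Definition measurable_wrt (G : set (set Omega)) (Y : Omega -> R) : Prop :=
  preimage_set_system [set: Omega] Y measurable `<=` G.

Definition adapted T F X : Prop :=
  forall t : R, 0 <= t <= T -> measurable_wrt (F t) (X t).

Definition continuous_paths P T X : Prop :=
  {ae P, forall w, {within `[0, T], continuous (fun t => X t w)}}.

Definition brownian_motion P T F W : Prop :=
  [/\ adapted T F W,
      continuous_paths P T W,
      {ae P, forall w, W 0 w = 0},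
      forall s t : R, 0 <= s -> s < t -> t <= T -> forall B : set R, measurable B ->
        P ((W t \- W s)%R @^-1` B) = normal_prob 0 (Num.sqrt (t - s)) B
    & forall s t : R, 0 <= s -> s < t -> t <= T ->
        forall (A : set Omega) (B : set R), F s A -> measurable B ->
        P (A `&` (W t \- W s)%R @^-1` B) = (P A * P ((W t \- W s)%R @^-1` B))%E].

(* Encodes sum_(i < n) xi_i 1_(t_i, t_(i+1)]; entries of the two sequences
   beyond the index range are irrelevant. *)
Record simple_process := SimpleProcess {
  simple_size : nat ;
  simple_time : nat -> R ;
  simple_coef : nat -> Omega -> R }.

Definition simple_on T F (S : simple_process) : Prop :=
  [/\ 0 <= simple_time S 0%N,
      simple_time S (simple_size S) <= T,
      forall i, (i < simple_size S)%N -> simple_time S i <= simple_time S i.+1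
    & forall i, (i < simple_size S)%N ->
        measurable_wrt (F (simple_time S i)) (simple_coef S i) /\
        exists C : R, forall w, `|simple_coef S i w| <= C].

Definition simple_val (S : simple_process) (s : R) (w : Omega) : R :=
  \sum_(i < simple_size S)
    simple_coef S i w * \1_(`]simple_time S i, simple_time S i.+1]) s.

Definition simple_int (S : simple_process) W (t : R) (w : Omega) : R :=
  \sum_(i < simple_size S) simple_coef S i w *
    (W (Num.min (simple_time S i.+1) t) w - W (Num.min (simple_time S i) t) w).

(* The outer measure of P is used because, with path regularity only almost
   sure, the event need not be measurable; it agrees with P on measurable
   events. *)
Definition cvg_in_probability0 P (Y : nat -> Omega -> \bar R) : Prop :=
  forall eps : R, 0 < eps ->
    mu_ext P [set w | (eps%:E < `|Y n w|)%E] @[n --> \oo] --> 0%E.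

(* I is (a continuous version of) the Ito integral (int_0^t H dW)_(t in [0,T]):
   I is determined up to indistinguishability by these conditions. *)
Definition ito_integral P T F W H I : Prop :=
  [/\ adapted T F H,
      {ae P, forall w, measurable_fun `[0, T] (fun s => H s w) /\
        (\int[lebesgue_measure]_(s in `[0%R, T]) (H s w ^+ 2)%:E < +oo)%E},
      continuous_paths P T I
    & exists S : nat -> simple_process,
        [/\ forall n, simple_on T F (S n),
            cvg_in_probability0 P (fun n w =>
              \int[lebesgue_measure]_(s in `[0%R, T])
                ((simple_val (S n) s w - H s w) ^+ 2)%:E)%E
          & forall t : R, 0 <= t <= T ->
              cvg_in_probability0 P (fun n w =>
                (simple_int (S n) W t w - I t w)%:E)]].

Definition sde_solution P T F W (b : R -> R -> R) (sigma : R -> R) (x : R) X :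
    Prop :=
  [/\ adapted T F X,
      continuous_paths P T X,
      {ae P, forall w, lebesgue_measure.-integrable `[0, T]
                         (fun s => (b s (X s w))%:E)}
    & exists I, ito_integral P T F W (fun s w => sigma (X s w)) I /\
        {ae P, forall w, forall t : R, 0 <= t <= T ->
          X t w = x + \int[lebesgue_measure]_(s in `[0, t]) b s (X s w)
                    + I t w}].

(* The restriction to B of the law of Y is absolutely continuous; the function
   below is the library's [mrestr], which would additionally take a proof that
   B is measurable. *)
Definition admits_density_on P (Y : Omega -> R) (B : set R) : Prop :=
  (fun A => pushforward P Y (A `&` B)) `<< (@lebesgue_measure R).

End stochastic_integral.

(* Main.v *)
Require Import Defs.
From HB Require Import structures.
From mathcomp Require Import all_boot all_order all_algebra.
From mathcomp Require Import all_classical all_reals all_analysis.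
From mathcomp Require Import measurable_realfun ring lra.

(* The one-step Euler argument of Fournier and Printems, in an L^1 form that
   avoids Fourier transforms and moment bounds. By (i) and (ii), sigma is
   locally Lipschitz. Localise by w = psi(X_t) 1{|X| <= N on [0, t]}, with psi a
   Lipschitz cutoff supported in a bounded part of {|sigma| >= delta}.
   Over [t - h^8, t] the solution stays within h^3 of its starting point and
   within h^6 of Z = X_s + sigma(X_s)(W_t - W_s), up to probability O(h^2); both
   bounds come from the inequality
     P(sup |int H dW| > a, int H^2 <= c) <= const * c / a^2.
   Conditionally on F_s, Z is Gaussian with standard deviation at least
   delta h^4, so shifting it by O(h^5) costs O(h) in total variation. Hence
   E[w G(X_t)] <= E[w G(X_t + k)] + O(h) when 0 <= G <= 1 is h^-5-Lipschitz and
   k = O(h^5). For G = g_eta, the average of the indicator of an open set U over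
   [x, x + eta], this compares g_eta with g_(32 eta), and summing over the scales
   eta = (h / 2^n)^5 gives E[w 1_U(X_t)] <= C |U| / h^5 + O(h). Take U to be a
   small neighbourhood of a null set, then let h tend to 0. *)

Set Implicit Arguments.
Unset Strict Implicit.
Unset Printing Implicit Defensive.

Import Order.TTheory GRing.Theory Num.Theory.
Import numFieldNormedType.Exports.

Local Open Scope classical_set_scope.
Local Open Scope ring_scope.

(** * Gaussian integrals *)

(** The exponents are chosen so that every error is at most of order h: such errors both sum over
    the dyadic scales and vanish with h. A time step h^8 gives a Gaussian of width about h^4, so a
    shift by h^5 costs h. An excursion beyond h^3 has probability of order h^8 / h^6. Without one,
    the integrand sigma(X_r) - sigma(X_s) is O(h^3), and an Euler error beyond h^6 has probability
    of order h^6 h^8 / h^12. Tested against a function of slope h^-5, an Euler error h^6 costs h.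

    The Gaussian step needs a weight known at time s, the conclusion a weight at time t, so the two
    are exchanged. The indicator inside the weight is discontinuous; it does no harm because psi
    vanishes in the outer layer of width one of the ball of radius N.

    Paths are continuous only almost surely and the filtration is not assumed complete, so suprema
    over time need not be measurable. Events are therefore tested at rational times or measured by
    the outer probability. *)

Section gaussian.
Context {R : realType}.
Local Notation mu := (@lebesgue_measure R).
Implicit Types (f : R -> \bar R) (m s k : R).

Lemma ge0_integral_lebesgue_shift f k : measurable_fun [set: R] f ->
  (forall x, 0 <= f x)%E ->
  (\int[mu]_x f x = \int[mu]_x f (x + k)%R)%E.
Proof.
move=> mf f0.
have mk : measurable_fun [set: R] ((fun x => x + k) : R -> measurableTypeR R).
  exact: measurable_funD.
have -> : (\int[mu]_x f (x + k)%R = \int[pushforward mu ((fun x => x + k)%R : R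
  -> measurableTypeR R)]_x f x)%E.
  by rewrite (@ge0_integral_pushforward _ _ (measurableTypeR R)
    (measurableTypeR R) R _ mk mu setT f).
apply: eq_measure_integral => A mA _.
apply: lebesgue_measure_unique => //= _ [[a b]] _ <-.
rewrite /pushforward (_ : _ @^-1` _ = `]a - k, b - k]%classic); last first.
  by apply/seteqP; split => x /=; rewrite !in_itv/= ltrBlDr lerBrDr.
rewrite /= !lebesgue_measure_itv/= !lte_fin ltrD2r.
case: ifP => // _; rewrite -!EFinB; congr EFin; ring.
Qed.

Lemma ge0_integral_lebesgueN f : measurable_fun [set: R] f ->
  (forall x, 0 <= f x)%E -> (\int[mu]_x f x = \int[mu]_x f (- x)%R)%E.
Proof.
move=> mf f0.
have mk : measurable_fun [set: R] ((fun x => - x) : R -> measurableTypeR R).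
  exact: oppr_measurable.
have -> : (\int[mu]_x f (- x)%R = \int[pushforward mu ((fun x => - x)%R : R ->
  measurableTypeR R)]_x f x)%E.
  by rewrite (@ge0_integral_pushforward _ _ (measurableTypeR R)
    (measurableTypeR R) R _ mk mu setT f).
apply: eq_measure_integral => A mA _; exact/esym/lebesgue_measureN.
Qed.

Lemma ge0_integral_normal_prob m s f : measurable_fun [set: R] f ->
  (forall x, 0 <= f x)%E ->
  (\int[normal_prob m s]_x f x = \int[mu]_x (f x * (normal_pdf m s x)%:E))%E.
Proof.
move=> mf f0.
have numu := @normal_prob_dominates R m s.
rewrite -(Radon_Nikodym_SigmaFinite.change_of_variables numu)//=.
have mpdf : measurable_fun [set: R] (fun x : R => (normal_pdf m s x)%:E).
  by apply/measurable_EFinP; exact: measurable_normal_pdf.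
have mint := Radon_Nikodym_SigmaFinite.f_integrable numu.
have mrn := measurable_int _ mint.
apply: ae_eq_integral => //.
- exact: emeasurable_funM.
- exact: emeasurable_funM.
(* The Radon-Nikodym derivative and the Gaussian density agree almost everywhere because they have
   the same integral over every measurable set. *)
- apply: ae_eqe_mul2l; apply: integral_ae_eq => //= E _ mE.
  by rewrite -Radon_Nikodym_SigmaFinite.f_integral.
Qed.

Lemma normal_pdf_neq0 m s x : s != 0 ->
  normal_pdf m s x = normal_peak s * expR (- (x - m) ^+ 2 / (s ^+ 2 *+ 2)).
Proof. by move=> s0; rewrite normal_pdfE. Qed.

Lemma normal_peak_mul s : 0 < s -> normal_peak s <= 2 * normal_peak (2 * s).
Proof.
move=> s0; rewrite /normal_peak.
rewrite (_ : (2 * s) ^+ 2 * pi *+ 2 = 2 ^+ 2 * (s ^+ 2 * pi *+ 2)); last ring.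
by rewrite sqrtrM ?sqr_ge0// sqrtr_sqr normr_nat invfM mulrA divff// mul1r.
Qed.

(* [x <= e^x] trades the square for a Gaussian of twice the width. *)
Lemma normal_sqr_le s : 0 < s ->
  (\int[normal_prob 0 s]_z (z ^+ 2)%:E <= (8 * s ^+ 2)%:E)%E.
Proof.
move=> s0; have sn0 : s != 0 by rewrite gt_eqF.
have s2n0 : 2 * s != 0 by rewrite mulf_neq0.
rewrite ge0_integral_normal_prob//=; last 2 first.
- by apply/measurable_EFinP; exact: measurable_funX.
- by move=> x; rewrite lee_fin sqr_ge0.
have -> : ((8 * s ^+ 2)%:E = (8 * s ^+ 2)%:E * \int[mu]_x (normal_pdf 0 (2 * s)
  x)%:E :> \bar R)%E.
  by rewrite integral_normal_pdf mule1.
rewrite -ge0_integralZl//; last 3 first.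
- by apply/measurable_EFinP; exact: measurable_normal_pdf.
- by move=> x _; rewrite lee_fin normal_pdf_ge0.
- by rewrite lee_fin mulr_ge0// sqr_ge0.
apply: ge0_le_integral => //.
- by move=> x _; rewrite -EFinM lee_fin mulr_ge0 ?sqr_ge0 ?normal_pdf_ge0.
- apply: emeasurable_funM; apply/measurable_EFinP.
    exact: measurable_funX.
  exact: measurable_normal_pdf.
- apply: emeasurable_funM; apply/measurable_EFinP => //.
  exact: measurable_normal_pdf.
move=> x _; rewrite -!EFinM lee_fin !normal_pdf_neq0// !subr0.
set v := s ^+ 2 *+ 2; have v0 : 0 < v by rewrite pmulrn_lgt0// exprn_gt0.
have vs : (2 * s) ^+ 2 *+ 2 = 4 * v by rewrite /v; ring.
rewrite vs.
(* A quarter of the exponent is that of the Gaussian of width [2 * s]; the other three quarters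
   absorb the factor [x ^+ 2]. *)
have fE (w : R) : w != 0 ->
    - x ^+ 2 / w = - (3/4) * (x ^+ 2 / w) + - x ^+ 2 / (4 * w).
  by move=> w0; field.
rewrite (fE v (lt0r_neq0 v0)).
set y := x ^+ 2 / v.
have xE : x ^+ 2 = y * v by rewrite /y divfK ?gt_eqF.
have y0 : 0 <= y by rewrite divr_ge0 ?sqr_ge0 ?ltW.
rewrite expRD.
have yle : y * expR (- (3/4) * y) <= 4/3.
  have -> : - (3/4) * y = - (3/4*y) by ring.
  rewrite expRN ler_pdivrMr ?expR_gt0//.
  have := expR_ge1Dx (3/4*y); lra.
have pk := normal_peak_mul s0; have e0 := expR_ge0 (- x ^+ 2 / (4 * v)).
have p0 := normal_peak_ge0 s; have p20 := normal_peak_ge0 (2 * s).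
have -> : 8 * s ^+ 2 = 4 * v by rewrite /v; ring.
move: e0 yle; set B := expR _ => e0; set A := expR _ => yle; rewrite xE.
have -> : y * v * (normal_peak s * (A * B)) = (y * A) * (v * normal_peak s * B)
  by ring.
apply: (@le_trans _ _ (4/3 * (v * normal_peak s * B))).
  by rewrite ler_wpM2r// !mulr_ge0// ltW.
have -> : 4 * v * (normal_peak (2 * s) * B) = 2 * (v * (2 * normal_peak (2 *
  s)) * B) by ring.
have h1 : v * normal_peak s * B <= v * (2 * normal_peak (2 * s)) * B.
  by rewrite ler_wpM2r// ler_wpM2l// ltW.
have h2 : 0 <= v * normal_peak s * B by rewrite !mulr_ge0// ltW.
lra.
Qed.

(** Averaging over [k] and [- k], which the symmetry of the centred Gaussian allows, removes the
    cross term, so that only integrals of non-negative functions occur. *)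
Lemma normal_quad_le s m k : 0 < s ->
  (\int[normal_prob 0 s]_z ((m + k * z) ^+ 2)%:E
    <= (m ^+ 2 + 8 * s ^+ 2 * k ^+ 2)%:E)%E.
Proof.
move=> s0; have sn0 : s != 0 by rewrite gt_eqF.
have mq (a : R) : measurable_fun [set: R] (fun z : R => ((m + a * z) ^+ 2)%:E).
  apply/measurable_EFinP; apply: measurable_funX; exact: measurable_funD.
have q0 (a z : R) : (0 <= ((m + a * z) ^+ 2)%:E :> \bar R)%E.
  by rewrite lee_fin sqr_ge0.
pose J (a : R) : \bar R := (\int[normal_prob 0 s]_z ((m + a * z) ^+ 2)%:E)%E.
pose J2 : \bar R := (\int[normal_prob 0 s]_z (z ^+ 2)%:E)%E.
have sym : J k = J (- k).
  rewrite /J !ge0_integral_normal_prob//.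
  rewrite ge0_integral_lebesgueN; last 2 first.
  - apply: emeasurable_funM; first exact: mq.
    by apply/measurable_EFinP; exact: measurable_normal_pdf.
  - by move=> x; rewrite mule_ge0// lee_fin normal_pdf_ge0.
  apply: eq_integral => z _; rewrite !normal_pdf_neq0// !subr0 sqrrN.
  by congr ((_ ^+ 2)%:E * _)%E; ring.
have Jsum : (J k + J (- k)%R =
            2%:E * (m ^+ 2)%:E + (2 * k ^+ 2)%:E * J2)%E.
  rewrite /J /J2 -ge0_integralD//; try exact: mq; try by move=> ? _; exact: q0.
  rewrite -ge0_integralZl//; last 3 first.
  - by apply/measurable_EFinP; exact: measurable_funX.
  - by move=> z _; rewrite lee_fin sqr_ge0.
  - by rewrite lee_fin mulr_ge0// sqr_ge0.
  have {1}-> : (2%:E * (m ^+ 2)%:E = \int[normal_prob 0 s]_z (cst (2 * m ^+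
    2)%:E z) :> \bar R)%E.
    by rewrite integral_cst// [X in _ = (_ * X)%E]probability_setT mule1 -EFinM.
  rewrite -ge0_integralD//; last 3 first.
  - by move=> z _; rewrite lee_fin; apply: mulr_ge0 => //; exact: sqr_ge0.
  - move=> z _; rewrite -EFinM lee_fin; apply: mulr_ge0; last exact: sqr_ge0.
    by apply: mulr_ge0 => //; exact: sqr_ge0.
  - apply: emeasurable_funM => //; apply/measurable_EFinP.
    exact: measurable_funX.
  apply: eq_integral => z _; rewrite -EFinM -!EFinD; congr EFin; ring.
have sq : (J2 <= (8 * s ^+ 2)%:E)%E by exact: normal_sqr_le.
have sqf : (0 <= J2)%E.
  by apply: integral_ge0 => z _; rewrite lee_fin sqr_ge0.
have Q0 : (0 <= J k)%E by exact: integral_ge0.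
move: Jsum; rewrite -sym => {sym}.
rewrite -/(J k); move: Q0 sqf sq.
case: J2 => [b|//|//]; case: (J k) => [a|//|//].
rewrite -!EFinM -!EFinD !lee_fin => a0 b0 b8 [E].
have : k ^+ 2 * b <= k ^+ 2 * (8 * s ^+ 2) by rewrite ler_wpM2l// sqr_ge0.
lra.
Qed.

(* [p(z) - p(z - k) <= p(z) (k ^ 2 - 2 z k) / (2 s ^ 2)] by [1 + u <= e ^ u],
   where [p] is the density of [normal_prob 0 s]. *)
Lemma normal_shift_le s k (g : R -> R) : 0 < s -> measurable_fun [set: R] g ->
  (forall x, 0 <= g x <= 1) ->
  (\int[normal_prob 0 s]_z (g z)%:E <= \int[normal_prob 0 s]_z (g (z + k)%R)%:E
     + (k ^+ 2 / s ^+ 2 + 5 * `|k| / s)%:E)%E.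
Proof.
move=> s0 mg g01; have sn0 : s != 0 by rewrite gt_eqF.
have g0 x : (0 <= (g x)%:E)%E by rewrite lee_fin; have /andP[] := g01 x.
have mgE : measurable_fun [set: R] (EFin \o g) by exact/measurable_EFinP.
have mp (m : R) : measurable_fun [set: R] (fun x : R => (normal_pdf m s x)%:E).
  by apply/measurable_EFinP; exact: measurable_normal_pdf.
have mshift (a : R) : measurable_fun [set: R] (fun x : R => x + a).
  exact: measurable_funD.
have p0 m x : (0 <= (normal_pdf m s x)%:E)%E by rewrite lee_fin normal_pdf_ge0.
have -> : (\int[normal_prob 0 s]_z (g (z + k)%R)%:E =
          \int[mu]_z ((g z)%:E * (normal_pdf k s z)%:E))%E.
  have mgk : measurable_fun [set: R] (fun z : R => (g (z + k))%:E).
    by apply/measurable_EFinP; exact: (measurableT_comp mg (mshift k)).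
  rewrite (ge0_integral_normal_prob _ _ mgk (fun z => g0 (z + k))).
  have mgp : measurable_fun [set: R]
      (fun z : R => (g z)%:E * (normal_pdf k s z)%:E)%E.
    exact: (emeasurable_funM mgE (mp k)).
  have gp0 (z : R) : (0 <= (g z)%:E * (normal_pdf k s z)%:E)%E.
    by rewrite mule_ge0.
  rewrite [RHS](ge0_integral_lebesgue_shift k mgp gp0).
  apply: eq_integral => z _; congr (_ * _%:E)%E.
  by rewrite !normal_pdf_neq0// subr0 addrK.
(* By [2 * |z| <= s + z ^+ 2 / s], the relative loss of density is at most [c1 + c2 * z ^+ 2].
   Integrating with [normal_sqr_le] gives the coefficient 1/2 + 8/2 of [|k| / s], rounded up to
   5. *)
pose c1 := k ^+ 2 / (2 * s ^+ 2) + `|k| / (2 * s).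
pose c2 := `|k| / (2 * s ^+ 3).
have c10 : 0 <= c1.
  by rewrite addr_ge0// divr_ge0 ?sqr_ge0// ?mulr_ge0 ?sqr_ge0// ltW.
have c20 : 0 <= c2 by rewrite divr_ge0// mulr_ge0// exprn_ge0// ltW.
have mz2 : measurable_fun [set: R] (fun x : R => (x ^+ 2)%:E).
  by apply/measurable_EFinP; exact: measurable_funX.
have err : (\int[normal_prob 0 s]_z (c1 + c2 * z ^+ 2)%:E <=
            (k ^+ 2 / s ^+ 2 + 5 * `|k| / s)%:E)%E.
  have m2 : measurable_fun [set: R] (fun x : R => c2%:E * (x ^+ 2)%:E)%E.
    exact: emeasurable_funM.
  rewrite (_ : (\int[normal_prob 0 s]_z (c1 + c2 * z ^+ 2)%:E)%E =
      (\int[normal_prob 0 s]_z (cst c1%:E z + c2%:E * (z ^+ 2)%:E))%E)//.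
  rewrite ge0_integralD//; last first.
    by move=> z _; rewrite -EFinM lee_fin; apply: mulr_ge0 => //; exact: sqr_ge0.
  rewrite integral_cst// [X in (_ * X + _)%E]probability_setT mule1.
  rewrite ge0_integralZl//; last by move=> z _; rewrite lee_fin sqr_ge0.
  apply: (@le_trans _ _ (c1%:E + c2%:E * (8 * s ^+ 2)%:E)%E).
    by rewrite leeD2l// lee_wpmul2l ?lee_fin// normal_sqr_le.
  rewrite -EFinM -EFinD lee_fin /c1 /c2.
  have -> : k ^+ 2 / (2 * s ^+ 2) + `|k| / (2 * s) + `|k| / (2 * s ^+ 3) * (8 *
    s ^+ 2)
     = k ^+ 2 / s ^+ 2 / 2 + 9 / 2 * (`|k| / s) by field.
  have ks : 0 <= k ^+ 2 / s ^+ 2 by rewrite divr_ge0 ?sqr_ge0.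
  have ks' : 0 <= `|k| / s by rewrite divr_ge0// ltW.
  rewrite -(mulrA 5); lra.
apply: le_trans (leeD2l _ err).
rewrite !ge0_integral_normal_prob//; last 2 first.
- apply/measurable_EFinP; apply: measurable_funD => //.
  by apply: measurable_funM => //; exact: measurable_funX.
- by move=> x; rewrite lee_fin addr_ge0// mulr_ge0// sqr_ge0.
have mc : measurable_fun [set: R] (fun x : R => (c1 + c2 * x ^+ 2)%:E).
  apply/measurable_EFinP; apply: measurable_funD => //.
  by apply: measurable_funM => //; exact: measurable_funX.
have c0 (x : R) : (0 <= (c1 + c2 * x ^+ 2)%:E)%E.
  by rewrite lee_fin addr_ge0// mulr_ge0// sqr_ge0.
have m1 := emeasurable_funM mgE (mp k).
have m2 := emeasurable_funM mc (mp 0).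
have m3 := emeasurable_funM mgE (mp 0).
rewrite -ge0_integralD//; last 2 first.
- by move=> x _; apply: mule_ge0; [exact: g0|exact: p0].
- by move=> x _; apply: mule_ge0; [exact: c0|exact: p0].
apply: ge0_le_integral => //.
- by move=> x _; apply: mule_ge0; [exact: g0|exact: p0].
- exact: emeasurable_funD.
move=> z _; rewrite -!EFinM -EFinD lee_fin.
have /andP[gz0 gz1] := g01 z.
rewrite !normal_pdf_neq0// subr0.
set E := expR (- z ^+ 2 / (s ^+ 2 *+ 2)).
set D := (2 * z * k - k ^+ 2) / (s ^+ 2 *+ 2).
have -> : - (z - k) ^+ 2 / (s ^+ 2 *+ 2) = - z ^+ 2 / (s ^+ 2 *+ 2) + D.
  by rewrite /D; field.
rewrite expRD -/E.
have Dge : 1 + D <= expR D by exact: expR_ge1Dx.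
have Dle : - D <= c1 + c2 * z ^+ 2.
  rewrite /D /c1 /c2.
  have -> : - ((2 * z * k - k ^+ 2) / (s ^+ 2 *+ 2)) =
            k ^+ 2 / (2 * s ^+ 2) + - (z * k) / s ^+ 2 by field.
  rewrite -addrA lerD2l.
  have -> : `|k| / (2 * s) + `|k| / (2 * s ^+ 3) * z ^+ 2 =
            (`|k| * (s + z ^+ 2 / s) / 2) / s ^+ 2 by field.
  rewrite ler_pM2r ?invr_gt0 ?exprn_gt0//.
  have h : 2 * `|z| <= s + z ^+ 2 / s.
    rewrite -subr_ge0 -real_normK ?num_real//.
    have -> : s + `|z| ^+ 2 / s - 2 * `|z| = (s - `|z|) ^+ 2 / s by field.
    by rewrite divr_ge0 ?sqr_ge0// ltW.
  have h2 : - (z * k) <= `|k| * `|z|.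
    by rewrite -normrM mulrC -normrN ler_norm.
  have h3 : `|k| * (2 * `|z|) <= `|k| * (s + z ^+ 2 / s) by rewrite ler_wpM2l.
  lra.
have pE : 0 <= normal_peak s * E by rewrite mulr_ge0 ?normal_peak_ge0 ?expR_ge0.
set p := normal_peak s in pE *; set c := c1 + _ in Dle *.
have -> : g z * (p * (E * expR D)) + c * (p * E) =
          (g z * expR D + c) * (p * E) by ring.
rewrite ler_wpM2r//.
have h1 : g z * (1 + D) <= g z * expR D by rewrite ler_wpM2l.
have cc : 0 <= c by move: (c0 z); rewrite lee_fin.
have h2 : g z * - D <= c.
  apply: (@le_trans _ _ (g z * c)); first by rewrite ler_wpM2l.
  by rewrite ler_piMl.
lra.
Qed.

End gaussian.

(** * Independence and Brownian increments *)

Section independence.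
Context {R : realType} {d d1 d2 : measure_display} {Omega : measurableType d}
  {T1 : measurableType d1} {T2 : measurableType d2}.
Variables (P : probability Omega R) (nu : probability T2 R).

(** The joint law agrees with a product measure on rectangles, hence everywhere, and Tonelli
    integrates the second variable first. *)
Lemma ge0_expectation_indep (Y : Omega -> T1) (Z : Omega -> T2)
    (Phi : T1 * T2 -> \bar R) :
  measurable_fun [set: Omega] Y -> measurable_fun [set: Omega] Z ->
  (forall A B, measurable A -> measurable B ->
     P (Y @^-1` A `&` Z @^-1` B) = (P (Y @^-1` A) * nu B)%E) ->
  measurable_fun [set: T1 * T2] Phi -> (forall p, 0 <= Phi p)%E ->
  (\int[P]_w Phi (Y w, Z w) = \int[P]_w \int[nu]_z Phi (Y w, z))%E.
Proof.
move=> mY mZ ind mPhi Phi0.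
pose Y' : {mfun Omega >-> T1} := HB.pack Y (isMeasurableFun.Build _ _ _ _ Y mY).
pose m1 := distribution P Y'.
have mYZ : measurable_fun [set: Omega] (fun w => (Y w, Z w)).
  exact: measurable_fun_pair.
pose YZ : {mfun Omega >-> (T1 * T2)%type} :=
  HB.pack (fun w => (Y w, Z w)) (isMeasurableFun.Build _ _ _ _ _ mYZ).
pose m' := distribution P YZ.
transitivity (\int[m']_p Phi p)%E.
  by rewrite ge0_integral_distribution.
transitivity (\int[m1 \x nu]_p Phi p)%E.
  apply: eq_measure_integral => A mA _; apply/esym.
  by apply: product_measure_unique.
rewrite fubini_tonelli1//.
rewrite ge0_integral_distribution//; last by move=> p; exact: integral_ge0.
exact: measurable_fun_fubini_tonelli_F.
Qed.

End independence.

Section mfun_wrt.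
Context {d : measure_display} {Omega : measurableType d}.

(** Equipping [Omega] with the sigma-algebra generated by [G] makes the closure properties of
    measurable functions available for adapted ones. The codomain is arbitrary so that pairs of
    variables are covered. *)
Definition mfun_wrt (G : set (set Omega)) d' (T' : measurableType d')
    (Y : Omega -> T') : Prop :=
  measurable_fun [set: g_sigma_algebraType G] (Y : g_sigma_algebraType G -> T').

Lemma mfun_wrtS (G G' : set (set Omega)) d' (T' : measurableType d')
    (Y : Omega -> T') : G `<=` G' -> mfun_wrt G Y -> mfun_wrt G' Y.
Proof.
move=> GG' mY _ B mB; have := mY measurableT B mB.
by apply: sub_sigma_algebra2 => //.
Qed.

Lemma mfun_wrt_preimage (G : set (set Omega)) d' (T' : measurableType d')
    (Y : Omega -> T') (B : set T') :
  sigma_algebra [set: Omega] G -> mfun_wrt G Y -> measurable B ->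
  G (Y @^-1` B).
Proof.
move=> sG mY mB; have := mY measurableT B mB.
by rewrite setTI /measurable/= sigma_algebra_id.
Qed.

Lemma mfun_wrt_measurable (G : set (set Omega)) d' (T' : measurableType d')
    (Y : Omega -> T') :
  sigma_algebra [set: Omega] G -> G `<=` measurable -> mfun_wrt G Y ->
  measurable_fun [set: Omega] Y.
Proof.
move=> sG GM mY _ B mB; rewrite setTI; apply: GM.
exact: mfun_wrt_preimage.
Qed.

Lemma measurable_wrt_mfun (R : realType) (G : set (set Omega))
    (Y : Omega -> R) : measurable_wrt G Y -> mfun_wrt G Y.
Proof.
move=> mY _ B mB; apply: sub_sigma_algebra; apply: mY.
by exists B.
Qed.

Lemma mfun_wrt_set (G : set (set Omega)) (A : set Omega) :
  sigma_algebra [set: Omega] G ->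
  (@measurable _ (g_sigma_algebraType G) A) = G A.
Proof. by move=> sG; rewrite /measurable/= sigma_algebra_id. Qed.

End mfun_wrt.

Section increment.
Context {R : realType} {d : measure_display} {Omega : measurableType d}.
Variables (P : probability Omega R) (T : R) (F : R -> set (set Omega))
  (W : R -> Omega -> R).
Hypotheses (F_filtration : filtration T F) (W_brownian : brownian_motion P T F W).

Lemma mfun_wrt_F s d' (T' : measurableType d') (Y : Omega -> T') :
  0 <= s <= T -> mfun_wrt (F s) Y -> measurable_fun [set: Omega] Y.
Proof.
case: F_filtration => sF FM _ sT; apply: mfun_wrt_measurable; first exact: sF.
exact: FM.
Qed.

Lemma mfun_wrt_le s t d' (T' : measurableType d') (Y : Omega -> T') :
  0 <= s -> s <= t -> t <= T -> mfun_wrt (F s) Y -> mfun_wrt (F t) Y.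
Proof.
case: F_filtration => _ _ FF s0 st tT; apply: mfun_wrtS; exact: FF.
Qed.

Lemma mfun_wrt_brownian s : 0 <= s <= T -> mfun_wrt (F s) (W s).
Proof.
by case: W_brownian => aW _ _ _ _ sT; apply: measurable_wrt_mfun; exact: aW.
Qed.

Lemma measurable_brownian s : 0 <= s <= T -> measurable_fun [set: Omega] (W s).
Proof. by move=> sT; apply: (mfun_wrt_F sT); exact: mfun_wrt_brownian. Qed.

(** This freezing formula plays the part of conditional expectation throughout: what is known at
    time [s] is held fixed and the increment is integrated out. *)
Lemma ge0_expectation_increment s t d' (T' : measurableType d')
    (Y : Omega -> T') (Phi : T' * R -> \bar R) :
  0 <= s -> s < t -> t <= T -> mfun_wrt (F s) Y ->
  measurable_fun [set: T' * R] Phi -> (forall p, 0 <= Phi p)%E ->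
  (\int[P]_w Phi (Y w, (W t w - W s w)%R) =
   \int[P]_w \int[normal_prob 0 (Num.sqrt (t - s))]_z Phi (Y w, z))%E.
Proof.
move=> s0 st tT mY mPhi Phi0.
have sT : 0 <= s <= T by rewrite s0 (le_trans (ltW st)).
have tT' : 0 <= t <= T by rewrite tT (le_trans s0)// ltW.
apply: (@ge0_expectation_indep R d d' _ Omega T' _ P
  (normal_prob 0 (Num.sqrt (t - s))) Y (fun w => W t w - W s w)) => //.
- exact: (mfun_wrt_F sT).
- by apply: measurable_funB; exact: measurable_brownian.
move=> A B mA mB; case: W_brownian => _ _ _ nW iW.
have FA : F s (Y @^-1` A); last first.
  rewrite (iW s t s0 st tT _ _ FA mB); congr (_ * _)%E; exact: nW.
case: F_filtration => sF _ _; apply: mfun_wrt_preimage => //; exact: sF.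
Qed.

End increment.

(** * Maximal inequality for the stochastic integral *)

Section grid.
Context {R : realType} {d : measure_display} {Omega : measurableType d}.
Variables (P : probability Omega R) (T : R) (F : R -> set (set Omega))
  (W : R -> Omega -> R).
Hypotheses (F_filtration : filtration T F) (W_brownian : brownian_motion P T F W).
Variables (m : nat) (v : nat -> R) (eta : nat -> Omega -> R) (a c : R).
Hypotheses (v0 : 0 <= v 0%N) (vS : forall k, (k < m)%N -> v k <= v k.+1)
  (vm : v m <= T) (meta : forall k, (k < m)%N -> mfun_wrt (F (v k)) (eta k))
  (a0 : 0 < a) (c0 : 0 <= c).

(** [M] is the discrete stochastic integral of [eta] and [Q] its bracket. No moment of [eta] is
    assumed; stopping supplies the second moments. *)
Let M (k : nat) (w : Omega) : R :=
  \sum_(0 <= j < k) eta j w * (W (v j.+1) w - W (v j) w).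
Let Q (k : nat) (w : Omega) : R :=
  \sum_(0 <= j < k) eta j w ^+ 2 * (v j.+1 - v j).

Let v_le i k : (i <= k <= m)%N -> v i <= v k.
Proof.
elim: k => [|k ih]; first by rewrite leqn0 => /andP[/eqP->].
move=> /andP[]; rewrite leq_eqVlt => /orP[/eqP -> //|ik km].
by apply: (le_trans (ih _)); [rewrite -ltnS ik ltnW|exact: vS].
Qed.

Let vT k : (k <= m)%N -> 0 <= v k <= T.
Proof.
move=> km; rewrite (le_trans v0) ?v_le//=.
by apply: le_trans vm; apply: v_le; rewrite km leqnn.
Qed.

Let mfun_le i k d' (T' : measurableType d') (Y : Omega -> T') :
  (i <= k <= m)%N -> mfun_wrt (F (v i)) Y -> mfun_wrt (F (v k)) Y.
Proof.
move=> ikm; have /andP[ik km] := ikm; apply: (mfun_wrt_le F_filtration).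
- by have /andP[] := vT (leq_trans ik km).
- exact: v_le.
- by have /andP[] := vT km.
Qed.

Let mW i k : (i <= k <= m)%N -> mfun_wrt (F (v k)) (W (v i)).
Proof.
move=> ikm; apply: (mfun_le ikm); apply: (mfun_wrt_brownian W_brownian).
by apply: vT; case/andP: ikm => ik /(leq_trans ik).
Qed.

Let mM i k : (i <= k <= m)%N -> mfun_wrt (F (v k)) (M i).
Proof.
move=> /andP[ik km]; rewrite /mfun_wrt /M.
under eq_fun do rewrite big_mkord.
apply: measurable_sum => -[j ji]/=.
have jk : (j < k)%N := leq_trans ji ik.
apply: measurable_funM.
- apply: (@mfun_le j) => //; first by rewrite (ltnW jk) km.
  exact: meta (leq_trans jk km).
- by apply: measurable_funB; apply: mW; rewrite ?(ltnW jk) ?jk ?km.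
Qed.

(** The bracket is predictable, so a stopping rule may look at it one step ahead. *)
Let mQ k : (k < m)%N -> mfun_wrt (F (v k)) (Q k.+1).
Proof.
move=> km; rewrite /mfun_wrt /Q.
under eq_fun do rewrite big_mkord.
apply: measurable_sum => -[j jk]/=.
apply: measurable_funM => //; apply: measurable_funX.
apply: (@mfun_le j) => //; first by rewrite -ltnS jk ltnW.
exact: meta (leq_trans jk km).
Qed.

(* The walk is stopped before the first step after which it exceeds [a] or
   its bracket exceeds [c]. *)
Let ok (k : nat) (w : Omega) : bool :=
  all (fun j => `|M j w| <= a) (iota 0 k.+1) && (Q k.+1 w <= c).
Let xi (k : nat) (w : Omega) : R := (ok k w)%:R * eta k w.
Let N (k : nat) (w : Omega) : R :=
  \sum_(0 <= j < k) xi j w * (W (v j.+1) w - W (v j) w).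

Let mok k : (k < m)%N -> mfun_wrt (F (v k)) (ok k).
Proof.
move=> km; rewrite /mfun_wrt.
apply: (@measurable_and _ (g_sigma_algebraType (F (v k)))); last first.
  by apply: measurable_fun_ler => //; exact: mQ.
have : all (fun j => (j <= k)%N) (iota 0 k.+1).
  by apply/allP => j; rewrite mem_iota add0n ltnS => /andP[].
elim: (iota 0 k.+1) => [_|j s ih /= /andP[jk sk]].
  exact: measurable_cst.
apply: (@measurable_and _ (g_sigma_algebraType (F (v k)))); last exact: ih.
apply: measurable_fun_ler => //.
by apply: measurableT_comp => //; apply: mM; rewrite jk ltnW.
Qed.

Let mxi k : (k < m)%N -> mfun_wrt (F (v k)) (xi k).
Proof.
move=> km; apply: measurable_funM; last exact: meta.
have := mok km; rewrite /mfun_wrt => mo.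
rewrite (_ : (fun x => (ok k x)%:R) = (fun x => if ok k x then 1 else 0 : R)).
  by apply: measurable_fun_ifT.
by apply/funext => x; case: (ok k x).
Qed.

Let mN i k : (i <= k <= m)%N -> mfun_wrt (F (v k)) (N i).
Proof.
move=> /andP[ik km]; rewrite /mfun_wrt /N.
under eq_fun do rewrite big_mkord.
apply: measurable_sum => -[j ji]/=.
have jk : (j < k)%N := leq_trans ji ik.
apply: measurable_funM.
- apply: (@mfun_le j) => //; first by rewrite (ltnW jk) km.
  exact: mxi (leq_trans jk km).
- by apply: measurable_funB; apply: mW; rewrite ?(ltnW jk) ?jk ?km.
Qed.

Let mxiT k : (k < m)%N -> measurable_fun [set: Omega] (xi k).
Proof.
by move=> km; apply: (mfun_wrt_F F_filtration (vT (ltnW km))); exact: mxi.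
Qed.

Let mNT k : (k <= m)%N -> measurable_fun [set: Omega] (N k).
Proof.
by move=> km; apply: (mfun_wrt_F F_filtration (vT km)); apply: mN; rewrite leqnn.
Qed.

(** The factor 8 is the constant of [normal_quad_le]. *)
Let dv k : R := 8 * (v k.+1 - v k).

Let dv_ge0 k : (k < m)%N -> 0 <= dv k.
Proof. by move=> km; rewrite mulr_ge0// subr_ge0 vS. Qed.

Let mN2 k : (k <= m)%N -> measurable_fun [set: Omega] (fun w => (N k w ^+ 2)%:E).
Proof. by move=> km; apply/measurable_EFinP/measurable_funX/mNT. Qed.

Let mxi2 k : (k < m)%N ->
  measurable_fun [set: Omega] (fun w => (dv k * xi k w ^+ 2)%:E).
Proof.
by move=> km; apply/measurable_EFinP/measurable_funM => //;
  apply/measurable_funX/mxiT.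
Qed.

Let NS k w : N k.+1 w = N k w + xi k w * (W (v k.+1) w - W (v k) w).
Proof. by rewrite /N big_nat_recr. Qed.

(** Given the pair ([N k], [xi k]), known at time [v k], the next value is an affine function of an
    independent Gaussian, so [normal_quad_le] applies under the expectation. This replaces the
    orthogonality of martingale increments and requires no integrability. *)
Let expectation_step k : (k < m)%N ->
  (\int[P]_w (N k.+1 w ^+ 2)%:E <=
   \int[P]_w (N k w ^+ 2)%:E + \int[P]_w (dv k * xi k w ^+ 2)%:E)%E.
Proof.
move=> km; have [/andP[vk0 _] /andP[_ vkT]] := (vT (ltnW km), vT km).
rewrite -ge0_integralD//; last 4 first.
- by move=> w _; rewrite lee_fin sqr_ge0.
- exact: mN2 (ltnW km).
- by move=> w _; rewrite lee_fin; apply: mulr_ge0; [exact: dv_ge0|exact: sqr_ge0].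
- exact: mxi2.
(* Grid points may coincide; the increment then vanishes and no Gaussian law is available. *)
have := vS km; rewrite le_eqVlt => /orP[/eqP vv|vv].
  rewrite [leRHS](_ : _ = \int[P]_w (N k.+1 w ^+ 2)%:E)%E//.
  apply: eq_integral => w _.
  by rewrite NS /dv vv !subrr mulr0 mulr0 addr0 mul0r adde0.
pose Phi (p : (R * R) * R) : \bar R := ((p.1.1 + p.1.2 * p.2) ^+ 2)%:E.
have mPhi : measurable_fun [set: (R * R) * R] Phi.
  apply/measurable_EFinP; apply: measurable_funX; apply: measurable_funD.
    exact: measurableT_comp.
  apply: measurable_funM => //; exact: measurableT_comp.
have Phi0 p : (0 <= Phi p)%E by rewrite lee_fin sqr_ge0.
have mY : mfun_wrt (F (v k)) (fun w => (N k w, xi k w)).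
  apply: measurable_fun_pair; last exact: mxi.
  by apply: mN; rewrite leqnn ltnW.
rewrite (_ : (\int[P]_w (N k.+1 w ^+ 2)%:E)%E =
  (\int[P]_w Phi ((N k w, xi k w), (W (v k.+1) w - W (v k) w)%R))%E); last first.
  by apply: eq_integral => w _; rewrite NS.
rewrite (ge0_expectation_increment F_filtration W_brownian vk0 vv vkT mY mPhi
  Phi0).
apply: ge0_le_integral => //.
- by move=> w _; exact: integral_ge0.
- have mG := measurable_fun_fubini_tonelli_F (m2 := normal_prob 0 (Num.sqrt (v
    k.+1 - v k))) Phi mPhi Phi0.
  apply: (measurableT_comp mG).
  exact: (mfun_wrt_F F_filtration (vT (ltnW km)) mY).
- by apply: emeasurable_funD; [exact: mN2 (ltnW km)|exact: mxi2].
move=> w _; rewrite -EFinD.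
apply: (le_trans (normal_quad_le _ _ _)).
  by rewrite sqrtr_gt0 subr_gt0.
by rewrite sqr_sqrtr// subr_ge0 ltW.
Qed.

Let expectation_N k : (k <= m)%N ->
  (\int[P]_w (N k w ^+ 2)%:E <=
   \int[P]_w (\sum_(0 <= j < k) dv j * xi j w ^+ 2)%:E)%E.
Proof.
elim: k => [_|k ih km].
  rewrite /N; under eq_integral do rewrite big_nil expr0n/=.
  by under [leRHS]eq_integral do rewrite big_nil.
apply: (le_trans (expectation_step km)).
rewrite [leRHS](_ : _ =
  \int[P]_w ((\sum_(0 <= j < k) dv j * xi j w ^+ 2)%:E +
             (dv k * xi k w ^+ 2)%:E))%E; last first.
  by apply: eq_integral => w _; rewrite big_nat_recr.
rewrite ge0_integralD//.
- by rewrite leeD2r//; exact/ih/ltnW.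
- move=> w _; rewrite lee_fin big_mkord sumr_ge0// => -[j jk] _/=.
  by apply: mulr_ge0; [exact/dv_ge0/(ltn_trans jk)|exact: sqr_ge0].
- apply/measurable_EFinP; under eq_fun do rewrite big_mkord.
  apply: measurable_sum => -[j jk]/=.
  by apply/measurable_EFinP/mxi2/(ltn_trans jk).
- by move=> w _; rewrite lee_fin; apply: mulr_ge0; [exact: dv_ge0|exact: sqr_ge0].
- exact: mxi2.
Qed.

(** A step that is not [ok] contributes nothing, and at an [ok] step the whole sum up to it is at
    most [8 * Q k.+1]. *)
Let bracket_le k w : (k <= m)%N -> \sum_(0 <= j < k) dv j * xi j w ^+ 2 <= 8 * c.
Proof.
elim: k => [_|k ih km]; first by rewrite big_nil mulr_ge0.
have [okk|nok] := boolP (ok k w); last first.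
  by rewrite big_nat_recr//= /xi (negbTE nok) mul0r expr0n/= mulr0 addr0 ih//
    ltnW.
have /andP[_ Qc] := okk.
apply: le_trans (_ : 8 * Q k.+1 w <= _); last by rewrite ler_pM2l.
rewrite /Q mulr_sumr !big_mkord; apply: ler_sum => -[j jk] _ /=.
rewrite /xi exprMn /dv -mulrA ler_pM2l// mulrC ler_wpM2r//.
  by rewrite subr_ge0 vS// (leq_trans jk).
by case: ok; rewrite ?expr1n ?mul1r// expr0n/= mul0r sqr_ge0.
Qed.

(** Let [k0] be the first index with [|M k0| > a]. All steps before [k0] are kept, since [Q] is
    non-decreasing, and all later ones are dropped, so [N m] equals [M k0]. Thus Chebyshev at the
    single index [m] controls the maximum. *)
Let exceed_N w k : (k <= m)%N -> a < `|M k w| -> Q k w <= c -> a < `|N m w|.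
Proof.
move=> km aM Qc.
have ex : exists k, (k <= m)%N && (a < `|M k w|) by exists k; rewrite km.
case: (ex_minnP ex) => k0 /andP[k0m aM0] k0min.
have k0k : (k0 <= k)%N by apply: k0min; rewrite km.
have Qmono i j : (i <= j <= m)%N -> Q i w <= Q j w.
  move=> /andP[ij jm]; rewrite /Q (big_cat_nat (leq0n i) ij)//= lerDl.
  rewrite big_nat_cond sumr_ge0// => l /andP[/andP[_ lj] _].
  by rewrite mulr_ge0 ?sqr_ge0// subr_ge0 vS// (leq_trans lj).
suff -> : N m w = M k0 w by [].
rewrite /N (big_cat_nat (leq0n k0) k0m)//= [X in _ + X]big_nat_cond [X in _ +
  X]big1 ?addr0.
  rewrite /M big_nat_cond [RHS]big_nat_cond; apply: eq_bigr => j /andP[/andP[_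
    jk0] _].
  rewrite /xi (_ : ok j w) ?mul1r//; apply/andP; split.
    apply/allP => i; rewrite mem_iota add0n ltnS => /andP[_ ij].
    rewrite leNgt; apply/negP => aMi.
    have : (k0 <= i)%N.
      by apply: k0min; rewrite aMi (leq_trans ij)// (leq_trans (ltnW jk0)).
    by rewrite leqNgt (leq_ltn_trans ij).
  apply: (le_trans (Qmono _ k _)) => //; rewrite km andbT.
  exact: leq_trans k0k.
move=> j /andP[/andP[k0j _] _]; rewrite /xi (_ : ok j w = false) ?mul0r//.
apply/negP => /andP[/allP/(_ k0)].
by rewrite mem_iota add0n ltnS k0j/= leNgt aM0 => /(_ isT).
Qed.

Lemma grid_maximal_inequality :
  (mu_ext P [set w | (exists k, [/\ (k <= m)%N,
      a < `|\sum_(0 <= j < k) eta j w * (W (v j.+1) w - W (v j) w)| &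
      \sum_(0 <= j < k) eta j w ^+ 2 * (v j.+1 - v j) <= c])%R]
   <= (8 * c / a ^+ 2)%:E)%E.
Proof.
pose E := [set w | a < `|N m w|].
have mNm := mNT (leqnn m).
have mE : measurable E.
  have mabs : measurable_fun [set: Omega] (fun w => `|N m w|).
    exact: measurableT_comp.
  have := mabs measurableT _ (measurable_itv `]a, +oo[).
  rewrite setTI; congr measurable; apply/seteqP; split=> w /=;
    by rewrite in_itv/= andbT.
apply: (@le_trans _ _ (mu_ext P E)).
  by apply: le_outer_measure => w [k [km aM Qc]]; exact: (exceed_N km).
rewrite measurable_mu_extE//.
have a2 : 0 < a ^+ 2 by rewrite exprn_gt0.
rewrite EFinM lee_pdivlMr//.
rewrite muleC -integral_cst//.
apply: (@le_trans _ _ (\int[P]_(w in E) (N m w ^+ 2)%:E)%E).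
  apply: ge0_le_integral => //.
  - by move=> w _; rewrite lee_fin ltW.
  - by apply: measurable_funTS; apply: mN2.
  - move=> w /= aN; rewrite lee_fin -[leRHS]real_normK ?num_real//.
    by rewrite ler_pXn2r ?nnegrE// ltW.
apply: (@le_trans _ _ (\int[P]_w (N m w ^+ 2)%:E)%E).
  apply: ge0_subset_integral => //; first exact: mN2.
  by move=> w _; rewrite lee_fin sqr_ge0.
apply: (le_trans (expectation_N (leqnn m))).
apply: (@le_trans _ _ (\int[P]_w (cst (8 * c)%:E w))%E).
  apply: ge0_le_integral => //.
  - move=> w _; rewrite lee_fin big_mkord sumr_ge0// => -[j jk] _/=.
    by apply: mulr_ge0; [exact/dv_ge0|exact: sqr_ge0].
  - apply/measurable_EFinP; under eq_fun do rewrite big_mkord.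
    by apply: measurable_sum => -[j jk]/=; apply/measurable_EFinP/mxi2.
  - by move=> w _; rewrite lee_fin; exact: bracket_le.
by rewrite integral_cst// [X in (_ * X)%E]probability_setT mule1.
Qed.

End grid.

(** * Simple integrands *)

Section simple_process_maximal.
Context {R : realType} {d : measure_display} {Omega : measurableType d}.
Variables (P : probability Omega R) (T : R) (F : R -> set (set Omega))
  (W : R -> Omega -> R).
Hypotheses (F_filtration : filtration T F) (W_brownian : brownian_motion P T F W).
Variables (S : @simple_process R d Omega) (S_simple : simple_on T F S).

Let tm := simple_time S.
Let n := simple_size S.

Let tm_le i j : (i <= j <= n)%N -> tm i <= tm j.
Proof.
case: S_simple => _ _ tS _.
elim: j => [|j ih]; first by rewrite leqn0 => /andP[/eqP->].
move=> /andP[]; rewrite leq_eqVlt => /orP[/eqP -> //|ij jn].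
by apply: (le_trans (ih _)); [rewrite -ltnS ij ltnW|exact: tS].
Qed.

Let tm_ge0 i : (i <= n)%N -> 0 <= tm i.
Proof.
case: (S_simple) => t0 _ _ _ ni; apply: (le_trans t0).
by apply: tm_le; rewrite ni.
Qed.

Let tm_leT i : (i <= n)%N -> tm i <= T.
Proof.
case: (S_simple) => _ tT _ _ ni; apply: le_trans tT.
by apply: tm_le; rewrite ni leqnn.
Qed.

(** On such an interval []x, y]] the simple process is constant, equal to its value at the right
    endpoint. *)
Let gap (x y : R) := forall i, (i <= n)%N -> tm i <= x \/ y <= tm i.

Let indic_gap x y r i : gap x y -> x < r <= y -> (i < n)%N ->
  \1_(`]tm i, tm i.+1]) r = \1_(`]tm i, tm i.+1]) y :> R.
Proof.
move=> g /andP[xr ry] iN; rewrite !indicE; congr (_%:R); congr nat_of_bool.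
apply/idP/idP; rewrite !inE/= !in_itv/= => /andP[h1 h2]; apply/andP; split.
- exact: lt_le_trans ry.
- case: (g i.+1) => // h.
  by move: (lt_le_trans xr h2); rewrite ltNge h.
- case: (g i (ltnW iN)) => h; first exact: le_lt_trans xr.
  by move: h1; rewrite ltNge h.
- exact: le_trans h2.
Qed.

Let simple_val_gap x y r w : gap x y -> x < r <= y ->
  simple_val S r w = simple_val S y w.
Proof.
by move=> g xry; apply: eq_bigr => -[i iN] _ /=; rewrite (indic_gap g xry iN).
Qed.

Let simple_int_gap x y w : x < y -> gap x y ->
  simple_int S W y w = simple_int S W x w + simple_val S y w * (W y w - W x w).
Proof.
move=> xy g; rewrite /simple_int /simple_val mulr_suml -big_split/=.
apply: eq_bigr => -[i iN] _ /=.
rewrite -mulrA -mulrDr; congr (_ * _).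
rewrite indicE -/(tm i) -/(tm i.+1).
have tt : tm i <= tm i.+1 by apply: tm_le; rewrite leqnSn.
case: (g i (ltnW iN)) => h1; case: (g i.+1 iN) => h2.
- rewrite !min_l ?(le_trans h1 (ltW xy)) ?(le_trans h2 (ltW xy))//.
  rewrite memNset ?mul0r ?addr0//= in_itv/= => /andP[_].
  by move/(lt_le_trans xy); rewrite ltNge h2.
- rewrite (min_r h2) (min_l (le_trans h1 (ltW xy))) (min_r (le_trans (ltW xy)
    h2)) (min_l h1).
  rewrite mem_set ?mul1r/=; last by rewrite in_itv/= h2 (le_lt_trans h1).
  by ring.
- by move: (le_trans (le_trans h1 tt) h2); rewrite leNgt xy.
- rewrite (min_r h2) (min_r h1) (min_r (le_trans (ltW xy) h2)) (min_r (le_trans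
    (ltW xy) h1)).
  rewrite memNset ?mul0r ?addr0 ?subrr//= in_itv/= => /andP[].
  by rewrite ltNge h1.
Qed.

Lemma measurable_simple_val w : measurable_fun [set: R] (fun r => simple_val S
  r w).
Proof.
apply: measurable_sum => i; apply: measurable_funM => //.
Qed.

Variables (s : R) (D : seq R) (zeta : Omega -> R) (a c : R).
Hypotheses (s0 : 0 <= s) (sD : forall u, u \in D -> s <= u <= T)
  (mzeta : mfun_wrt (F s) zeta) (a0 : 0 < a) (c0 : 0 <= c) (sT : s <= T).

(* The times of [S] and the points of [D] merged into one grid from [s]: the
   integrand [S - zeta] is constant between consecutive grid points. *)
Let L := sort <=%R (s :: D ++ [seq r <- map tm (iota 0 n.+1) | s <= r]).
Let v := nth 0 L.
Let m := (size L).-1.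

Let sizeL : size L = m.+1.
Proof. by rewrite /m /L size_sort. Qed.

Let mem_L u : (u \in L) = (u \in s :: D ++ [seq r <- map tm (iota 0 n.+1) | s
  <= r]).
Proof. by rewrite /L mem_sort. Qed.

Let L_itv u : u \in L -> s <= u <= T.
Proof.
rewrite mem_L inE => /orP[/eqP ->|]; first by rewrite lexx.
rewrite mem_cat => /orP[/sD //|]; rewrite mem_filter => /andP[su] /mapP[i].
by rewrite mem_iota add0n ltnS => /andP[_ iN] uE; rewrite su uE tm_leT.
Qed.

Let v_mem k : (k <= m)%N -> v k \in L.
Proof. by move=> km; rewrite mem_nth// sizeL ltnS. Qed.

Let v_le i k : (i <= k <= m)%N -> v i <= v k.
Proof.
move=> /andP[ik km]; apply: (sorted_leq_nth le_trans lexx 0) => //.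
- exact: sort_le_sorted.
- by rewrite inE sizeL ltnS (leq_trans ik).
- by rewrite inE sizeL ltnS.
Qed.

Let v_index u : u \in L -> exists2 k, (k <= m)%N & u = v k.
Proof.
move=> uL; exists (index u L); last by rewrite /v nth_index.
by rewrite -ltnS -sizeL index_mem.
Qed.

Let v0 : v 0%N = s.
Proof.
apply/eqP; rewrite eq_le; apply/andP; split; last first.
  by have /andP[] := L_itv (v_mem (leq0n m)).
have [|k km ->] := @v_index s; first by rewrite mem_L inE eqxx.
exact: v_le.
Qed.

Let v_gap k : (k < m)%N -> gap (v k) (v k.+1).
Proof.
move=> km i iN; have [st|ts] := leP s (tm i); last first.
  by left; apply: (le_trans (ltW ts)); have /andP[] := L_itv (v_mem (ltnW km)).
have [|j jm ->] := @v_index (tm i).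
  rewrite mem_L inE mem_cat mem_filter st map_f ?orbT// mem_iota add0n ltnS.
  by rewrite iN.
have [jk|kj] := leqP j k; first by left; apply: v_le; rewrite jk ltnW.
by right; apply: v_le; rewrite kj.
Qed.

Let eta (k : nat) (w : Omega) : R :=
  if v k < v k.+1 then simple_val S (v k.+1) w - zeta w else 0.

(** The value is read at [v k.+1] but known at [v k]: a coefficient active at [v k.+1] starts at
    some [tm i < v k.+1], and [v_gap] then gives [tm i <= v k]. *)
Let meta k : (k < m)%N -> mfun_wrt (F (v k)) (eta k).
Proof.
move=> km; rewrite /mfun_wrt /eta.
case: (boolP (v k < v k.+1)) => [vv|_]; last exact: measurable_cst.
have /andP[svk vkT] := L_itv (v_mem (ltnW km)).
apply: measurable_funB; last exact: (mfun_wrt_le F_filtration s0 svk vkT mzeta).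
apply: measurable_sum => -[i iN]/=; under eq_fun do rewrite indicE.
case: (boolP (v k.+1 \in _)) => [|_]; last first.
  by under eq_fun do rewrite mulr0; exact: measurable_cst.
rewrite inE/= in_itv/= => /andP[tv _].
have tvk : tm i <= v k.
  case: (v_gap km (ltnW iN)) => // h; by move: tv; rewrite ltNge h.
under eq_fun do rewrite mulr1.
case: (S_simple) => _ _ _ /(_ i iN)[mc _].
apply: (mfun_wrt_le F_filtration (tm_ge0 (ltnW iN)) tvk vkT).
exact: measurable_wrt_mfun.
Qed.

Let walkE k w : (k <= m)%N ->
  \sum_(0 <= j < k) eta j w * (W (v j.+1) w - W (v j) w) =
  simple_int S W (v k) w - simple_int S W s w - zeta w * (W (v k) w - W s w).
Proof.
elim: k => [_|k ih km]; first by rewrite big_nil v0 !subrr mulr0 subrr.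
rewrite big_nat_recr//= ih ?(ltnW km)// /eta.
case: ifPn => [vv|]; first by rewrite (simple_int_gap w vv (v_gap km)); ring.
rewrite -leNgt => vv; have -> : v k.+1 = v k.
  by apply/eqP; rewrite eq_le vv v_le// leqnSn.
by rewrite subrr mulr0 addr0.
Qed.

Let sq w (r : R) : \bar R := ((simple_val S r w - zeta w) ^+ 2)%:E.

Let msq w (D' : set R) : measurable_fun D' (sq w).
Proof.
apply: measurable_funTS; apply/measurable_EFinP; apply: measurable_funX.
by apply: measurable_funB => //; exact: measurable_simple_val.
Qed.

Let sq_ge0 w r : (0 <= sq w r)%E.
Proof. by rewrite lee_fin sqr_ge0. Qed.

Let bracketE k w : (k <= m)%N ->
  ((\sum_(0 <= j < k) eta j w ^+ 2 * (v j.+1 - v j))%:E =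
  \int[lebesgue_measure]_(r in `]s, v k]) sq w r)%E.
Proof.
elim: k => [_|k ih km].
  by rewrite big_nil v0 set_itv_ge ?bnd_simp ?ltxx// integral_set0.
rewrite big_nat_recr//= EFinD ih ?(ltnW km)//.
have vv : v k <= v k.+1 by apply: v_le; rewrite leqnSn.
have sv : s <= v k by have /andP[] := L_itv (v_mem (ltnW km)).
rewrite (@itv_bndbnd_setU _ _ (BRight s) (BRight (v k)) (BRight (v k.+1)))
  ?bnd_simp//.
rewrite ge0_integral_setU//=; last 2 first.
  exact: msq.
  apply/disj_setPS => r [] /=; rewrite !in_itv/= => /andP[_ rv] /andP[vr _].
  by move: vr; rewrite ltNge rv.
congr (_ + _)%E.
rewrite /eta; case: (boolP (v k < v k.+1)) => [lt|]; last first.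
  rewrite -leNgt => v2; rewrite set_itv_ge ?bnd_simp -?leNgt// integral_set0.
  by rewrite expr0n/= mul0r.
rewrite (eq_integral (cst (sq w (v k.+1)))); last first.
  move=> r; rewrite inE/= in_itv/= => rv.
  by rewrite /sq (simple_val_gap w (v_gap km) rv).
by rewrite integral_cst//= lebesgue_measure_itv/= lte_fin lt -EFinB -EFinM.
Qed.

Lemma simple_int_maximal_inequality :
  (mu_ext P [set w | exists u, [/\ u \in D,
      (a < `|simple_int S W u w - simple_int S W s w
             - zeta w * (W u w - W s w)|)%R &
      \int[lebesgue_measure]_(r in `[s, u])
        ((simple_val S r w - zeta w) ^+ 2)%:E <= c%:E]]
   <= (8 * c / a ^+ 2)%:E)%E.
Proof.
apply: le_trans (grid_maximal_inequality F_filtration W_brownian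
  (m := m) (v := v) (eta := eta) (a := a) (c := c) _ _ _ _ _ _) => //.
- apply: le_outer_measure => w [u [uD aI cI]].
  have [|k km uE] := @v_index u.
    by rewrite mem_L inE mem_cat uD orbT.
  exists k; rewrite km walkE// -uE; split => //.
  rewrite -lee_fin bracketE//; apply: le_trans cI; rewrite -uE.
  apply: ge0_subset_integral => //; first exact: msq.
  by move=> r /=; rewrite !in_itv/= => /andP[/ltW -> ->].
- by rewrite v0.
- by move=> k km; apply: v_le; rewrite leqnSn.
- by have /andP[] := L_itv (v_mem (leqnn m)).
Qed.

End simple_process_maximal.

(** * Outer probability and vanishing events *)

Section outer_probability.
Context {R : realType} {d : measure_display} {Omega : measurableType d}.
Variable P : probability Omega R.

Lemma mu_extU (A B : set Omega) :
  (mu_ext P (A `|` B) <= mu_ext P A + mu_ext P B)%E.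
Proof. exact: outer_measureU2. Qed.

Lemma mu_ext_negligible (A : set Omega) :
  P.-negligible A -> mu_ext P A = 0%E.
Proof.
move=> [B [mB PB AB]]; apply/eqP; rewrite eq_le outer_measure_ge0 andbT.
by rewrite -PB -(measurable_mu_extE _ mB); exact: le_outer_measure.
Qed.

Definition small_sets (A : nat -> set Omega) : Prop :=
  mu_ext P (A n) @[n --> \oo] --> 0%E.

Lemma small_setsU (A B C : nat -> set Omega) :
  (forall n, C n `<=` A n `|` B n) -> small_sets A -> small_sets B ->
  small_sets C.
Proof.
move=> CAB sA sB.
apply: (@squeeze_cvge _ _ _ _ (cst 0%E) _
  (fun n => mu_ext P (A n) + mu_ext P (B n))%E); last 2 first.
- exact: cvg_cst.
- by rewrite -[X in _ --> X]adde0; apply: cvgeD.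
apply: nearW => n; rewrite outer_measure_ge0/=.
by apply: le_trans (mu_extU _ _); exact: le_outer_measure.
Qed.

Lemma small_sets_seq (I : eqType) (D : seq I) (A : I -> nat -> set Omega) :
  (forall u, u \in D -> small_sets (A u)) ->
  small_sets (fun n => [set w | exists2 u, u \in D & A u n w]).
Proof.
elim: D => [_|u D ih sA].
  rewrite /small_sets (_ : (fun n => _) = cst 0%E); first exact: cvg_cst.
  apply/funext => n; rewrite (_ : [set w | _] = set0) ?outer_measure0//.
  by apply/seteqP; split => w // [].
apply: (@small_setsU (A u) (fun n => [set w | exists2 u, u \in D & A u n w])).
- move=> n w [u']; rewrite inE => /orP[/eqP -> |u'D Aw]; first by left.
  by right; exists u'.
- by apply: sA; rewrite mem_head.
- by apply: ih => u' u'D; apply: sA; rewrite inE u'D orbT.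
Qed.

Lemma mu_ext_le_small (B : set Omega) (A C : nat -> set Omega) (e : R) :
  (forall n, B `<=` A n `|` C n) -> small_sets C ->
  (forall n, mu_ext P (A n) <= e%:E)%E -> (mu_ext P B <= e%:E)%E.
Proof.
move=> BAC sC Ae.
have h : (e%:E + mu_ext P (C n) @[n --> \oo] --> e%:E)%E.
  by rewrite -[X in _ --> X]adde0; apply: cvgeD => //; exact: cvg_cst.
apply: (cvge_to_ge h); apply: nearW => n.
apply: (@le_trans _ _ (mu_ext P (A n) + mu_ext P (C n))%E).
  by apply: le_trans (mu_extU _ _); exact: le_outer_measure.
exact: leeD2r.
Qed.

End outer_probability.

(** * Passage to the Ito integral *)

Section ito_maximal.
Context {R : realType} {d : measure_display} {Omega : measurableType d}.
Variables (P : probability Omega R) (T : R) (F : R -> set (set Omega))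
  (W H I : R -> Omega -> R).
Hypotheses (F_filtration : filtration T F) (W_brownian : brownian_motion P T F W)
  (HI : ito_integral P T F W H I).
Variables (s : R) (D : seq R) (zeta : Omega -> R) (a c : R).
Hypotheses (s0 : 0 <= s) (sT : s <= T) (sD : forall u, u \in D -> s <= u <= T)
  (mzeta : mfun_wrt (F s) zeta) (a0 : 0 < a) (c0 : 0 < c).

(** Outside events of vanishing outer probability, the approximation errs by at most [a / 4] at [s]
    and at [u], leaving the threshold [a / 2], and its bracket is at most [2 * c + 2 * c]. The
    simple case with these values gives 8 * 4 * 4 = 128. Convergence in probability at each time
    suffices because [D] is finite. The inequality serves twice: with [zeta] zero for the size of an
    excursion, and with [zeta] equal to [sigma (X s)] for the Euler error. *)
Lemma ito_maximal_inequality :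
  (mu_ext P [set w | exists u, [/\ u \in D,
      (a < `|I u w - I s w - zeta w * (W u w - W s w)|)%R &
      \int[lebesgue_measure]_(r in `[s, u]) ((H r w - zeta w) ^+ 2)%:E <= c%:E]]
   <= (128 * c / a ^+ 2)%:E)%E.
Proof.
case: HI => _ Hmeas _ [S [S_simple SH SI]].
pose bad1 n := [set w | (c%:E < `|\int[lebesgue_measure]_(r in `[0%R, T])
  ((simple_val (S n) r w - H r w) ^+ 2)%:E|)%E].
pose bad2 (u : R) n := [set w |
  ((a / 4)%:E < `|(simple_int (S n) W u w - I u w)%:E|)%E].
pose bad0 := [set w | ~ (measurable_fun `[0, T] (fun r => H r w) /\
  (\int[lebesgue_measure]_(r in `[0%R, T]) (H r w ^+ 2)%:E < +oo)%E)].
pose A n := [set w | exists u, [/\ u \in D,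
  (a / 2 < `|simple_int (S n) W u w - simple_int (S n) W s w
     - zeta w * (W u w - W s w)|)%R &
  (\int[lebesgue_measure]_(r in `[s, u])
     ((simple_val (S n) r w - zeta w) ^+ 2)%:E <= (4 * c)%:E)%E]].
pose C n := bad0 `|` (bad1 n `|` [set w | exists2 u, u \in s :: D & bad2 u n w]).
apply: (@mu_ext_le_small _ _ _ _ _ A C).
- move=> n w [u [uD aI Hc]].
  have [Cw|nC] := pselect (C n w); [by right|left; exists u].
  have /not_orP[/contrapT [mH _] /not_orP[/negP]] := nC.
  rewrite -leNgt => b1 b2.
  have I_le u' : u' \in s :: D -> `|simple_int (S n) W u' w - I u' w| <= a / 4.
    by move=> u'D; rewrite leNgt; apply/negP => h; apply: b2; exists u'.
  have h1 := I_le _ (mem_head _ _).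
  have h2 : `|simple_int (S n) W u w - I u w| <= a / 4.
    by apply: I_le; rewrite inE uD orbT.
  split => //.
    rewrite ltNge; apply/negP => h3; move: aI; rewrite ltNge => /negP; apply.
    move: h1 h2 h3; rewrite !ler_norml => /andP[? ?] /andP[? ?] /andP[? ?].
    by apply/andP; split; lra.
  have /andP[su uT] := sD uD.
  have suT : `[s, u] `<=` `[0, T].
    move=> r /=; rewrite !in_itv/= => /andP[sr ru].
    by rewrite (le_trans s0)// (le_trans ru).
  have mHs : measurable_fun `[s, u] (fun r => H r w).
    by apply: measurable_funS mH.
  have mS (E : set R) : measurable_fun E (fun r => simple_val (S n) r w).
    by apply: measurable_funTS; exact: measurable_simple_val.
  have mSH (E : set R) : measurable_fun E (fun r => H r w) ->
      measurable_fun E (fun r => (2 * (simple_val (S n) r w - H r w) ^+ 2)%:E).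
    move=> mE; apply/measurable_EFinP/measurable_funM => //.
    by apply: measurable_funX; apply: measurable_funB => //; exact: mS.
  have mHz : measurable_fun `[s, u] (fun r => (2 * (H r w - zeta w) ^+ 2)%:E).
    apply/measurable_EFinP/measurable_funM => //.
    by apply: measurable_funX; apply: measurable_funB.
  have ge02 (x : R) : (0 <= (2 * x ^+ 2)%:E)%E.
    by rewrite lee_fin mulr_ge0// sqr_ge0.
  apply: (@le_trans _ _ (\int[lebesgue_measure]_(r in `[s, u])
      ((2 * (simple_val (S n) r w - H r w) ^+ 2)%:E +
       (2 * (H r w - zeta w) ^+ 2)%:E))%E).
    apply: ge0_le_integral => //.
    - by move=> r _; rewrite lee_fin sqr_ge0.
    - by apply/measurable_EFinP; apply: measurable_funX; apply: measurable_funB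
        => //; exact: mS.
    - by apply: emeasurable_funD => //; exact: mSH.
    move=> r _; rewrite -EFinD lee_fin -subr_ge0.
    set x := simple_val _ _ _; set y := H _ _; set z := zeta _.
    have -> : 2 * (x - y) ^+ 2 + 2 * (y - z) ^+ 2 - (x - z) ^+ 2 =
      (x - y - (y - z)) ^+ 2 by ring.
    exact: sqr_ge0.
  rewrite ge0_integralD//; last exact: mSH.
  have -> : ((4 * c)%:E = (2 * c)%:E + (2 * c)%:E)%E by rewrite -EFinD; congr
    EFin; ring.
  apply: leeD.
    apply: (@le_trans _ _ (\int[lebesgue_measure]_(r in `[0%R, T])
      (2 * (simple_val (S n) r w - H r w) ^+ 2)%:E)%E).
      by apply: ge0_subset_integral => //; exact: mSH.
    under eq_integral do rewrite EFinM.
    rewrite ge0_integralZl//.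
    - by rewrite EFinM lee_wpmul2l ?lee_fin// (le_trans _ b1)// lee_abs.
    - by apply/measurable_EFinP; apply: measurable_funX; apply: measurable_funB
        => //; exact: mS.
    - by move=> r _; rewrite lee_fin sqr_ge0.
  under eq_integral do rewrite EFinM.
  rewrite ge0_integralZl//.
  - by rewrite EFinM lee_wpmul2l ?lee_fin.
  - by apply/measurable_EFinP; apply: measurable_funX; apply: measurable_funB.
  - by move=> r _; rewrite lee_fin sqr_ge0.
- apply: (@small_setsU _ _ _ _ (fun=> bad0) (fun n => bad1 n `|` [set w |
    exists2 u, u \in s :: D & bad2 u n w])).
    by move=> n; exact: subset_refl.
    have b00 : mu_ext P bad0 = 0%E by exact: mu_ext_negligible.
    by rewrite /small_sets/= b00; exact: cvg_cst.
  apply: (@small_setsU _ _ _ _ bad1 (fun n => [set w | exists2 u, u \in s :: D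
    & bad2 u n w])).
    by move=> n; exact: subset_refl.
    exact: SH.
  apply: small_sets_seq => u; rewrite inE => /orP[/eqP ->|uD].
    by apply: SI; [rewrite s0|rewrite divr_gt0].
  have /andP[su uT] := sD uD.
  by apply: SI; [rewrite uT (le_trans s0)|rewrite divr_gt0].
- move=> n; apply: (le_trans (simple_int_maximal_inequality F_filtration
    W_brownian (S_simple n) s0 sD mzeta _ _ sT)).
  + by rewrite divr_gt0.
  + by rewrite mulr_ge0// ltW.
  rewrite lee_fin le_eqVlt; apply/orP; left; apply/eqP.
  by field; rewrite gt_eqF.
Qed.

End ito_maximal.

(** * Continuous paths *)

Section continuous_path.
Context {R : realType}.
Implicit Types (f : R -> R) (T s t e M : R).

Lemma within_itv_dist_lt f T x e : {within `[0, T], continuous f} ->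
  0 <= x <= T -> 0 < e ->
  exists2 dl : R, 0 < dl &
    forall y, 0 <= y <= T -> `|x - y| < dl -> `|f x - f y| < e.
Proof.
move=> /subspace_continuousP cf x0T e0.
have xT : `[0, T]%classic x by rewrite /= in_itv.
have /cvgrPdist_lt/(_ _ e0) := cf x xT.
rewrite near_withinE => /nbhs_ballP[dl /= dl0 H].
by exists dl => // y yT xy; apply: (H y xy); rewrite /= in_itv.
Qed.

Lemma within_itv_rat_le f T s t M : {within `[0, T], continuous f} ->
  0 <= s -> s < t -> t <= T ->
  (forall q : rat, s <= ratr q <= t -> `|f (ratr q)| <= M) ->
  forall r, s <= r <= t -> `|f r| <= M.
Proof.
move=> cf s0 st tT fM r /andP[sr rt].
rewrite leNgt; apply/negP => Mf.
have rT : 0 <= r <= T by rewrite (le_trans s0 sr) (le_trans rt tT).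
have e0 : 0 < `|f r| - M by rewrite subr_gt0.
have [dl dl0 H] := within_itv_dist_lt cf rT e0.
have : Num.max s (r - dl) < Num.min t (r + dl).
  by rewrite lt_min !gt_max; apply/andP; split; apply/andP; split; lra.
move=> /rat_in_itvoo[q]; rewrite in_itv/= gt_max lt_min.
move=> /andP[/andP[sq rq] /andP[qt qr]].
have qM : `|f (ratr q)| <= M by apply: fM; rewrite !ltW.
have qT : (0 : R) <= ratr q <= T.
  by rewrite (le_trans s0 (ltW sq)) (le_trans (ltW qt)).
have := H _ qT; rewrite ltr_distlC => h.
have {h} := h _; rewrite rq qr => /(_ isT) h.
have := ler_dist_dist (f r) (f (ratr q)).
move=> /(le_trans (ler_norm _)); lra.
Qed.

(** The exact exit time may be irrational. Near the infimum [v] of the times at distance at least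
    [e], two errors of [e / 4] are allowed, from such a time to [v] and from [v] to a rational
    before it; hence the threshold [e / 2]. *)
Lemma within_itv_first_exit f T s q e : {within `[0, T], continuous f} ->
  0 <= s -> s <= q -> q <= T -> 0 < e -> e < `|f q - f s| ->
  exists u : rat, [/\ s < ratr u, ratr u < q, e / 2 < `|f (ratr u) - f s| &
    forall r, s <= r <= ratr u -> `|f r - f s| < e].
Proof.
move=> cf s0 sq qT e0 eq_.
pose A := [set r | s <= r <= q /\ e <= `|f r - f s|].
have Aq : A q by split; [rewrite sq lexx|exact: ltW].
have lbA : lbound A s by move=> r [/andP[]].
have hA : has_inf A by split; [exists q|exists s].
set v := inf A.
have sv : s <= v by apply: lb_le_inf => //; exists q.
have vq : v <= q by apply: ge_inf => //; exists s.
have vT : 0 <= v <= T by rewrite (le_trans s0 sv) (le_trans vq qT).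
have e4 : 0 < e / 4 by rewrite divr_gt0.
have [dl dl0 H] := within_itv_dist_lt cf vT e4.
have [r1 [/andP[sr1 r1q] er1] r1v] := inf_adherent dl0 hA.
have vr1 : v <= r1 by apply: ge_inf; [exists s|split; rewrite ?sr1].
have r1T : 0 <= r1 <= T by rewrite (le_trans s0 sr1) (le_trans r1q qT).
have d1 : `|f v - f r1| < e / 4 by apply: H => //; rewrite ltr_distlC; lra.
have tri (x y z : R) : `|x - z| <= `|x - y| + `|y - z|.
  by rewrite (le_trans _ (ler_normD _ _))// addrA subrK.
have fv : 3 / 4 * e < `|f v - f s|.
  have := tri (f r1) (f v) (f s); rewrite (distrC (f r1) (f v)); lra.
have sv' : s < v.
  rewrite lt_neqAle sv andbT; apply/negP => /eqP sE.
  by move: fv; rewrite -sE subrr normr0; lra.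
have : Num.max s (v - dl) < v by rewrite gt_max sv'; lra.
move=> /rat_in_itvoo[u]; rewrite in_itv/= gt_max => /andP[/andP[su vu] uv].
exists u; split => //.
- exact: lt_le_trans vq.
- have uT : (0 : R) <= ratr u <= T.
    by rewrite (le_trans s0 (ltW su)) (le_trans (ltW uv))//; case/andP: vT.
  have d2 : `|f v - f (ratr u)| < e / 4 by apply: H => //; rewrite ltr_distlC;
    lra.
  have := tri (f v) (f (ratr u)) (f s); lra.
- move=> r /andP[sr ru]; rewrite ltNge; apply/negP => er.
  have : v <= r.
    apply: ge_inf; first by exists s.
    by split => //; rewrite sr (le_trans ru)// (le_trans (ltW uv)).
  by rewrite leNgt (le_lt_trans ru uv).
Qed.

Lemma ge0_integral_le_cst (f : R -> \bar R) (D : set R) (M : R) s t :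
  D `<=` `[s, t] -> measurable D -> s <= t -> 0 <= M ->
  measurable_fun D f -> (forall r, D r -> 0 <= f r <= M%:E)%E ->
  (\int[lebesgue_measure]_(r in D) f r <= (M * (t - s))%:E)%E.
Proof.
move=> Dst mD st M0 mf fM.
apply: (@le_trans _ _ (\int[lebesgue_measure]_(r in D) cst M%:E r)%E).
  by apply: ge0_le_integral => // r Dr; have /andP[] := fM r Dr.
rewrite integral_cst// EFinM lee_wpmul2l ?lee_fin//.
apply: (@le_trans _ _ (lebesgue_measure `[s, t]%classic)).
  by apply: le_measure => //; rewrite inE//; exact: measurable_itv.
rewrite lebesgue_measure_itv/= lte_fin; case: ifP => // _.
by rewrite lee_fin subr_ge0.
Qed.

Lemma Rintegral_itv_increment_le (f : R -> R) s t T M :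
  lebesgue_measure.-integrable `[0, T] (EFin \o f) ->
  0 <= s -> s <= t -> t <= T -> 0 <= M ->
  (forall r, s <= r <= t -> `|f r| <= M) ->
  `|\int[lebesgue_measure]_(r in `[0, t]) f r
    - \int[lebesgue_measure]_(r in `[0, s]) f r| <= M * (t - s).
Proof.
move=> intf s0 st tT M0 fM.
have int_t : lebesgue_measure.-integrable `[0, t] (EFin \o f).
  apply: integrableS intf => //; move=> r /=; rewrite !in_itv/=.
  by move=> /andP[-> /le_trans ->].
rewrite Rintegral_itvB// ?bnd_simp//.
have sub : `]s, t] `<=` `[0, t].
  move=> r /=; rewrite !in_itv/= => /andP[sr ->].
  by rewrite (le_trans s0)// ltW.
have int_st : lebesgue_measure.-integrable `]s, t] (EFin \o f).
  exact: integrableS int_t.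
apply: (le_trans (le_normr_Rintegral _ int_st)) => //.
rewrite /Rintegral -lee_fin fineK; last first.
  have /integrableP[_] := int_st => foo.
  by rewrite ge0_fin_numE//; apply: integral_ge0 => r _; rewrite lee_fin.
apply: ge0_integral_le_cst => //.
- by move=> r /=; rewrite !in_itv/= => /andP[/ltW -> ->].
- have := measurable_int _ int_st => /measurable_EFinP mf.
  by apply/measurable_EFinP; exact: measurableT_comp.
- move=> r /=; rewrite in_itv/= => /andP[sr rt].
  by rewrite !lee_fin normr_ge0/= fM// rt ltW.
Qed.

End continuous_path.

(** * One-step estimates for the solution *)

Lemma bigcapT_measurable_rat d (T : measurableType d) (F : rat -> set T) :
  (forall q, measurable (F q)) -> measurable (\bigcap_q F q).
Proof.
move=> mF; rewrite -[X in measurable X]setCK setC_bigcap.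
by apply: measurableC; apply: bigcupT_measurable_rat => q; exact: measurableC.
Qed.

Section one_step.
Context {R : realType} {d : measure_display} {Omega : measurableType d}.
Variables (P : probability Omega R) (T : R) (F : R -> set (set Omega))
  (W : R -> Omega -> R) (b : R -> R -> R) (sigma : R -> R) (x : R)
  (X : R -> Omega -> R).
Hypotheses (F_filtration : filtration T F) (W_brownian : brownian_motion P T F W)
  (X_solution : sde_solution P T F W b sigma x X)
  (sigma_meas : measurable_fun [set: R] sigma).

Lemma mfun_wrt_solution s : 0 <= s <= T -> mfun_wrt (F s) (X s).
Proof.
by case: X_solution => aX _ _ _ sT; apply: measurable_wrt_mfun; exact: aX.
Qed.

Lemma measurable_solution s : 0 <= s <= T -> measurable_fun [set: Omega] (X s).
Proof.
by move=> sT; apply: (mfun_wrt_F F_filtration sT); exact: mfun_wrt_solution.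
Qed.

(** The radius is [N + 1] because a path bounded by [N] up to time [s] may still move by [rho <= 1]
    afterwards. *)
Variables (N C : R).
Hypotheses (C0 : 0 < C)
  (b_le : forall r y, 0 <= r <= T -> `|y| <= N + 1 -> `|b r y| <= C)
  (sigma_le : forall y, `|y| <= N + 1 -> `|sigma y| <= C)
  (sigma_lip : forall y z, `|y| <= N + 1 -> `|z| <= N + 1 ->
     `|sigma y - sigma z| <= C * `|y - z|).

(* Rational times make this an event of [F s]. *)
Definition stays (s : R) : set Omega :=
  [set w | forall q : rat, (0 : R) <= ratr q <= s -> `|X (ratr q) w| <= N].

Lemma F_stays s : 0 <= s <= T -> F s (stays s).
Proof.
move=> /andP[s0 sT]; have [sF _ _] := F_filtration.
rewrite -(mfun_wrt_set _ (sF s _)) ?s0//.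
rewrite (_ : stays s = \bigcap_(q : rat)
  [set w | (0 : R) <= ratr q <= s -> `|X (ratr q) w| <= N]); last first.
  by apply/seteqP; split => w /= h q; [move=> _; exact: h|exact: h].
apply: bigcapT_measurable_rat => q.
have [qs|nqs] := boolP ((0 : R) <= ratr q <= s); last first.
  rewrite (_ : [set w | _] = setT)//; apply/seteqP; split => w //.
have /andP[q0 q1] := qs.
have mX : mfun_wrt (F s) (fun w => `|X (ratr q) w|).
  apply: measurableT_comp => //.
  apply: (mfun_wrt_le F_filtration q0 q1 sT); apply: mfun_wrt_solution.
  by rewrite q0 (le_trans q1).
have := mX measurableT _ (measurable_itv `]-oo, N]).
rewrite setTI; congr measurable; apply/seteqP; split => w /=.
  by rewrite in_itv/= => h _.
by rewrite in_itv/= => /(_ isT).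
Qed.

Let I_ex : exists I, ito_integral P T F W (fun s w => sigma (X s w)) I /\
        {ae P, forall w, forall t : R, 0 <= t <= T ->
          X t w = x + \int[lebesgue_measure]_(s in `[0, t]) b s (X s w)
                    + I t w}.
Proof. by case: X_solution. Qed.

(** All almost sure path properties are gathered here, so that pathwise arguments discard a single
    negligible set. *)
Let regular (I : R -> Omega -> R) (w : Omega) : Prop :=
  [/\ {within `[0, T], continuous (fun t => X t w)},
      lebesgue_measure.-integrable `[0, T] (fun s => (b s (X s w))%:E),
      measurable_fun `[0, T] (fun s => sigma (X s w)) &
      forall t : R, 0 <= t <= T ->
          X t w = x + \int[lebesgue_measure]_(s in `[0, t]) b s (X s w)
                    + I t w].

Let ae_regular I : ito_integral P T F W (fun s w => sigma (X s w)) I ->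
  {ae P, forall w, forall t : R, 0 <= t <= T ->
          X t w = x + \int[lebesgue_measure]_(s in `[0, t]) b s (X s w)
                    + I t w} -> {ae P, forall w, regular I w}.
Proof.
move=> [_ m _ _] eqX; case: X_solution => _ cX ib _.
by apply: filterS2 (filterI m eqX) (filterI cX ib) => w [[mX _] eX] [c i]; split.
Qed.

Let drift_le I w s u : regular I w -> 0 <= s -> s <= u -> u <= T ->
  (forall r, s <= r <= u -> `|X r w| <= N + 1) ->
  `|(X u w - X s w) - (I u w - I s w)| <= C * (u - s).
Proof.
move=> [cX ib mX eqX] s0 su uT XN.
rewrite (eqX u) ?(le_trans s0 su)// (eqX s) ?s0 ?(le_trans su)//.
set A := (\int[_]_(_ in _) _)%R; set B := (\int[_]_(_ in _) _)%R.
rewrite (_ : _ - _ = A - B); last by ring.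
apply: (@Rintegral_itv_increment_le _ (fun r => b r (X r w)) s u T C) => //.
  exact: ltW.
move=> r sru; apply: b_le; last exact: XN.
by case/andP: sru => sr ru; rewrite (le_trans s0 sr) (le_trans ru uT).
Qed.

Variables (s t : R).
Hypotheses (s0 : 0 < s) (st : s < t) (tT : t <= T).

Let s0T : 0 <= s <= T.
Proof. by rewrite ltW// (le_trans (ltW st)). Qed.

Let sub_itv u : u <= t -> `[s, u] `<=` `[0, T].
Proof.
move=> ut r /=; rewrite !in_itv/= => /andP[sr ru].
by rewrite (le_trans (ltW s0))//= (le_trans ru)// (le_trans ut).
Qed.

Lemma regular_stays I w : regular I w -> stays s w ->
  forall r, 0 <= r <= s -> `|X r w| <= N.
Proof.
move=> [cX _ _ _] ws; apply: (within_itv_rat_le cX) => //.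
by apply: le_trans tT; exact: ltW.
Qed.

Section excursion.
Variable rho : R.
Hypotheses (rho0 : 0 < rho) (rho1 : rho <= 1) (rhoC : 4 * C * (t - s) <= rho).

Definition excursion : set Omega :=
  [set w | stays s w /\ exists q : rat, s <= ratr q <= t /\
     rho < `|X (ratr q) w - X s w|].

(** The coefficients are bounded only while the path stays in the ball, so the path is examined at a
    rational time before it leaves the [rho]-neighbourhood of [X s], when its displacement already
    exceeds [rho / 2]. By [rhoC] the drift accounts for at most [rho / 4], and the stochastic
    integral must exceed the remaining [rho / 4]. The bound holds for finitely many times;
    continuity from below extends it to all rationals, which is why [G m] has to be measurable. *)
Lemma mu_ext_excursion :
  (mu_ext P excursion <= (128 * (C ^+ 2 * (t - s)) / (rho / 4) ^+ 2)%:E)%E.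
Proof.
have [I [II eqX]] := I_ex.
have aer := ae_regular II eqX.
(* These are the rationals in [[s, t]] with code below [m]; a number that codes no rational yields
   the harmless default 0. *)
pose D (m : nat) : seq R := [seq u <- [seq ratr (odflt 0 (unpickle i)) | i <-
  iota 0 m] | s <= u <= t].
(* The path is only tested at rational times, which keeps [G m] measurable. *)
pose ex (u : R) := [set w | rho / 2 < `|X u w - X s w| /\
  forall q : rat, s <= ratr q <= u -> `|X (ratr q) w| <= N + 1].
pose G (m : nat) := [set w | exists2 u, u \in D m & ex u w].
have Dst m u : u \in D m -> s <= u <= t by rewrite mem_filter => /andP[].
have DT m u : u \in D m -> s <= u <= T.
  by move=> /Dst/andP[-> /le_trans]; exact.
have mG m : measurable (G m).
  have mS (E : seq R) : (forall u, u \in E -> s <= u <= T) ->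
     measurable [set w | exists2 u, u \in E & ex u w].
    elim: E => [_|u E ih EsT].
      by rewrite (_ : [set w | _] = set0)//; apply/seteqP; split => w // [].
    rewrite [X in measurable X](_ : _ =
      ex u `|` [set w | exists2 u, u \in E & ex u w]); last first.
      apply/seteqP; split => w.
        move=> [u']; rewrite inE => /orP[/eqP ->|u'E H]; first by left.
        by right; exists u'.
      move=> [H|[u' u'E H]]; first by exists u => //; rewrite mem_head.
      by exists u' => //; rewrite inE u'E orbT.
    apply: measurableU; last by apply: ih => u' u'E; apply: EsT; rewrite inE
      u'E orbT.
    have /andP[su uT] : s <= u <= T by apply: EsT; rewrite mem_head.
    have uT' : 0 <= u <= T by rewrite uT (le_trans (ltW s0)).
    rewrite [X in measurable X](_ : _ = [set w | rho / 2 < `|X u w - X s w|] `&`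
      \bigcap_(q : rat) [set w | s <= ratr q <= u -> `|X (ratr q) w| <= N +
        1]); last first.
      apply/seteqP; split => w /= [h1 h2]; split => // q; first by move=> _;
        exact: h2.
      exact: h2.
    apply: measurableI.
      have mX : measurable_fun [set: Omega] (fun w => `|X u w - X s w|).
        apply: measurableT_comp => //.
        by apply: measurable_funB; exact: measurable_solution.
      have := mX measurableT _ (measurable_itv `]rho / 2, +oo[).
      by rewrite setTI; congr measurable; apply/seteqP; split => w /=; rewrite
        in_itv/= andbT.
    apply: bigcapT_measurable_rat => q.
    have [qs|nqs] := boolP (s <= ratr q <= u); last first.
      rewrite (_ : [set w | _] = setT)//; apply/seteqP; split => w //.
    have /andP[q0 q1] := qs.
    have mX : measurable_fun [set: Omega] (fun w => `|X (ratr q) w|).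
      apply: measurableT_comp => //; apply: measurable_solution.
      by rewrite (le_trans (ltW s0) q0) (le_trans q1).
    have := mX measurableT _ (measurable_itv `]-oo, (N + 1)]).
    rewrite setTI; congr measurable; apply/seteqP; split => w /=.
      by rewrite in_itv/= => h _.
    by rewrite in_itv/= => /(_ isT).
  exact: mS (DT m).
have ndG : nondecreasing_seq G.
  move=> m n mn; apply/subsetPset => w [u uD H]; exists u => //.
  move: uD; rewrite !mem_filter => /andP[-> /mapP[i]].
  rewrite mem_iota add0n => /andP[_ im] ->; apply: map_f.
  by rewrite mem_iota add0n (leq_trans im).
have GP m : (P (G m) <= (128 * (C ^+ 2 * (t - s)) / (rho / 4) ^+ 2)%:E)%E.
  rewrite -measurable_mu_extE//.
  have Cts : 0 < C ^+ 2 * (t - s) by rewrite mulr_gt0 ?exprn_gt0// subr_gt0.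
  have r4 : 0 < rho / 4 by rewrite divr_gt0.
  have mz : mfun_wrt (F s) (fun=> 0 : R) by exact: measurable_cst.
  have := ito_maximal_inequality F_filtration W_brownian II (ltW s0)
    (le_trans (ltW st) tT) (@DT m) mz r4 Cts.
  set B := [set w | _] => PB.
  apply: (@le_trans _ _ (mu_ext P ([set w | ~ regular I w] `|` B))).
    apply: le_outer_measure => w [u uD [Xu XN]].
    have [rw|] := pselect (regular I w); [right|by left].
    have /andP[su ut] := Dst _ _ uD.
    have su' : s < u.
      rewrite lt_neqAle su andbT; apply/eqP => sE; move: Xu.
      by rewrite sE subrr normr0 ltNge divr_ge0// ltW.
    have [cX _ mX _] := rw.
    have uT := le_trans ut tT.
    have XN' := within_itv_rat_le cX (ltW s0) su' uT XN.
    have dr := drift_le rw (ltW s0) su uT XN'.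
    exists u; split => //.
      have cc : C * (u - s) <= rho / 4.
        have h : C * (u - s) <= C * (t - s) by rewrite ler_pM2l// lerD2r.
        rewrite ler_pdivlMr// mulrC (le_trans _ rhoC)// -mulrA ler_pM2l//.
      rewrite mul0r subr0.
      have := ler_normD (X u w - X s w - (I u w - I s w)) (I u w - I s w).
      rewrite subrK; lra.
    apply: (@le_trans _ _ (C ^+ 2 * (u - s))%:E); last first.
      by rewrite lee_fin ler_pM2l ?exprn_gt0// lerD2r.
    apply: ge0_integral_le_cst => //.
    - by rewrite sqr_ge0.
    - apply/measurable_EFinP; apply: measurable_funX; apply: measurable_funB =>
        //.
      by apply: measurable_funS mX => //; exact: sub_itv.
    - move=> r /=; rewrite in_itv/= => sru; rewrite !lee_fin sqr_ge0/= subr0.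
      rewrite -real_normK ?num_real// ler_pXn2r ?nnegrE ?(ltW C0)//.
      exact/sigma_le/XN'.
  apply: (le_trans (mu_extU _ _ _)).
  rewrite (mu_ext_negligible aer) add0e; exact: PB.
have mUG : measurable (\bigcup_m G m) by exact: bigcup_measurable.
have PUG : (P (\bigcup_m G m) <= (128 * (C ^+ 2 * (t - s)) / (rho / 4) ^+
  2)%:E)%E.
  apply: (cvge_to_le (nondecreasing_cvg_mu mG mUG ndG)).
  by apply: nearW => m; exact: GP.
apply: le_trans PUG; rewrite -(measurable_mu_extE P mUG).
apply: (@le_trans _ _ (mu_ext P ([set w | ~ regular I w] `|` \bigcup_m G m)));
  last first.
  by apply: (le_trans (mu_extU _ _ _)); rewrite (mu_ext_negligible aer) add0e.
apply: le_outer_measure => w [ws [q [/andP[sq qt] Xq]]].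
have [rw|] := pselect (regular I w); [right|by left].
have [cX _ mX _] := rw.
have [u [su uq Xu Xlt]] := within_itv_first_exit cX (ltW s0) sq (le_trans qt
  tT) rho0 Xq.
(* [D m] uses the codes strictly below [m], hence the successor. *)
exists (pickle u).+1 => //; exists (ratr u).
  rewrite mem_filter; apply/andP; split.
    by rewrite (ltW su) (le_trans (ltW uq) qt).
  apply/mapP; exists (pickle u); first by rewrite mem_iota add0n ltnS leqnn.
  by rewrite pickleK.
split => // q' /andP[sq' q'u].
have XsN : `|X s w| <= N by apply: (regular_stays rw ws); rewrite ltW//= lexx.
have Xq' := Xlt (ratr q'); rewrite sq' q'u in Xq'.
have := ler_normD (X (ratr q') w - X s w) (X s w); rewrite subrK.
have := Xq' isT; move: XsN rho1; lra.
Qed.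

(** Without an excursion, [sigma (X r)] stays within [C * rho] of [sigma (X s)], so the bracket of
    the error is at most [C ^+ 2 * rho ^+ 2 * (t - s)]. The drift takes one half of [a] and the
    stochastic integral the other. *)
Lemma mu_ext_euler a : 0 < a -> 2 * C * (t - s) <= a ->
  (mu_ext P [set w | stays s w /\
     (a < `|X t w - X s w - sigma (X s w) * (W t w - W s w)|)%R]
   <= (128 * (C ^+ 2 * (t - s)) / (rho / 4) ^+ 2 +
       128 * (C ^+ 2 * rho ^+ 2 * (t - s)) / (a / 2) ^+ 2)%:E)%E.
Proof.
move=> a0 Ca; have [I [II eqX]] := I_ex.
have aer := ae_regular II eqX.
have Cts : 0 < C ^+ 2 * rho ^+ 2 * (t - s).
  by rewrite !mulr_gt0 ?exprn_gt0// subr_gt0.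
have a2 : 0 < a / 2 by rewrite divr_gt0.
have mz : mfun_wrt (F s) (fun w => sigma (X s w)).
  by apply: measurableT_comp => //; exact: mfun_wrt_solution.
have DT u : u \in [:: t] -> s <= u <= T.
  by rewrite inE => /eqP ->; rewrite ltW.
have := ito_maximal_inequality F_filtration W_brownian II (ltW s0)
    (le_trans (ltW st) tT) DT mz a2 Cts.
set B := [set w | _] => PB.
apply: (@le_trans _ _ (mu_ext P ([set w | ~ regular I w] `|` (excursion `|` B)))).
  apply: le_outer_measure => w [ws aX].
  have [rw|] := pselect (regular I w); [right|by left].
  have [ew|ne] := pselect (excursion w); [by left|right].
  have [cX _ mX _] := rw.
  have cX' : {within `[0, T], continuous (fun r => X r w - X s w)}.
    move=> r; apply: cvgB; [exact: cX|exact: cvg_cst].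
  have Xrho r : s <= r <= t -> `|X r w - X s w| <= rho.
    move: r; apply: (within_itv_rat_le cX' (ltW s0) st tT) => q qst.
    rewrite leNgt; apply/negP => h; apply: ne; split => //.
    by exists q.
  have XsN : `|X s w| <= N by apply: (regular_stays rw ws); rewrite ltW//= lexx.
  have XN r : s <= r <= t -> `|X r w| <= N + 1.
    move=> srt; have := ler_normD (X r w - X s w) (X s w); rewrite subrK.
    have := Xrho r srt; move: XsN rho1; lra.
  have dr := drift_le rw (ltW s0) (ltW st) tT XN.
  exists t; split; first by rewrite inE.
    have := ler_normD (X t w - X s w - (I t w - I s w)) (I t w - I s w - sigma
      (X s w) * (W t w - W s w)).
    have Ca2 : C * (t - s) <= a / 2.
      by rewrite ler_pdivlMr// mulrC mulrA.
    rewrite addrA subrK; move: aX dr Ca2; lra.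
  apply: ge0_integral_le_cst => //.
  - exact: ltW.
  - by rewrite mulr_ge0// sqr_ge0.
  - apply/measurable_EFinP; apply: measurable_funX; apply: measurable_funB => //.
    by apply: measurable_funS mX => //; exact: sub_itv.
  - move=> r /=; rewrite in_itv/= => srt; rewrite !lee_fin sqr_ge0/= -exprMn.
    rewrite -real_normK ?num_real// ler_pXn2r ?nnegrE ?mulr_ge0 ?(ltW C0) ?(ltW
      rho0)//.
    apply: (le_trans (sigma_lip _ _)); first exact: XN.
      by apply: XN; rewrite lexx ltW.
    by rewrite ler_pM2l//; exact: Xrho.
apply: (le_trans (mu_extU _ _ _)); rewrite (mu_ext_negligible aer) add0e.
apply: (le_trans (mu_extU _ _ _)); rewrite EFinD; apply: leeD.
  exact: mu_ext_excursion.
exact: PB.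
Qed.

End excursion.

End one_step.

(** * Shift estimate for the law of the solution *)

(** A measurable cover is what lets a bad event enter an integral as an indicator. *)
Lemma mu_ext_lt_cover {R : realType} {d : measure_display}
    {Omega : measurableType d} (P : probability Omega R) (A : set Omega) (e :
      \bar R) :
  (mu_ext P A < e)%E ->
  exists B, [/\ measurable B, A `<=` B & (P B <= e)%E].
Proof.
move=> /ereal_inf_lt[_ [D [mD AD] <-]] De.
exists (\bigcup_n D n); split => //; first exact: bigcup_measurable.
apply: le_trans (ltW De); apply: measure_sigma_subadditive => //.
exact: bigcup_measurable.
Qed.

Section key_estimate.
Context {R : realType} {d : measure_display} {Omega : measurableType d}.
Variables (P : probability Omega R) (T : R) (F : R -> set (set Omega))
  (W : R -> Omega -> R) (b : R -> R -> R) (sigma : R -> R) (x : R)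
  (X : R -> Omega -> R).
Hypotheses (F_filtration : filtration T F) (W_brownian : brownian_motion P T F W)
  (X_solution : sde_solution P T F W b sigma x X)
  (sigma_meas : measurable_fun [set: R] sigma).
Variables (N C : R).
Hypotheses (C0 : 0 < C)
  (b_le : forall r y, 0 <= r <= T -> `|y| <= N + 1 -> `|b r y| <= C)
  (sigma_le : forall y, `|y| <= N + 1 -> `|sigma y| <= C)
  (sigma_lip : forall y z, `|y| <= N + 1 -> `|z| <= N + 1 ->
     `|sigma y - sigma z| <= C * `|y - z|).
Variables (psi : R -> R) (delta Bpsi Lpsi : R).
Hypotheses (psi_meas : measurable_fun [set: R] psi) (delta0 : 0 < delta)
  (psi_itv : forall y, 0 <= psi y <= Bpsi)
  (psi_supp : forall y, psi y != 0 -> `|y| <= N - 1 /\ delta <= `|sigma y|)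
  (Lpsi0 : 0 <= Lpsi)
  (psi_lip : forall y z, `|y| <= N + 1 -> `|z| <= N + 1 ->
     `|psi y - psi z| <= Lpsi * `|y - z|).

Definition weight (r : R) (w : Omega) : R := psi (X r w) * \1_(stays X N r) w.

Lemma weight_itv r w : 0 <= weight r w <= Bpsi.
Proof.
have /andP[p0 p1] := psi_itv (X r w).
rewrite /weight indicE; case: (w \in _); rewrite ?mulr1 ?mulr0 ?p0//.
by rewrite lexx (le_trans p0).
Qed.

Lemma mfun_wrt_weight r : 0 <= r <= T -> mfun_wrt (F r) (weight r).
Proof.
move=> rT; have [sF _ _] := F_filtration.
apply: measurable_funM.
  by apply: measurableT_comp => //; exact: (mfun_wrt_solution X_solution).
apply: (@measurable_indic _ (g_sigma_algebraType (F r))).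
by rewrite mfun_wrt_set; [exact: (F_stays F_filtration X_solution)|exact: sF].
Qed.

Lemma measurable_weight r : 0 <= r <= T -> measurable_fun [set: Omega] (weight r).
Proof. by move=> rT; apply: (mfun_wrt_F F_filtration rT); exact:
  mfun_wrt_weight. Qed.

Variables (s t rho a eta : R).
Hypotheses (s0 : 0 < s) (st : s < t) (tT : t <= T).
Hypotheses (rho0 : 0 < rho) (rho1 : rho <= 1) (rhoC : 4 * C * (t - s) <= rho)
  (a0 : 0 < a) (aC : 2 * C * (t - s) <= a) (eta0 : 0 < eta).

(** This is the bound of [mu_ext_excursion] plus that of [mu_ext_euler], which contains the former
    once more. *)
Let p : R := 128 * (C ^+ 2 * (t - s)) / (rho / 4) ^+ 2 +
  (128 * (C ^+ 2 * (t - s)) / (rho / 4) ^+ 2 +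
   128 * (C ^+ 2 * rho ^+ 2 * (t - s)) / (a / 2) ^+ 2).

Let p0 : 0 < p.
Proof.
have ts : 0 < t - s by rewrite subr_gt0.
have C2 : 0 < C ^+ 2 by rewrite exprn_gt0.
have r2 : 0 < rho ^+ 2 by rewrite exprn_gt0.
have h128 (y z : R) : 0 < y -> 0 < z -> 0 < 128 * y / z ^+ 2.
  move=> y0 z0; rewrite divr_gt0 ?exprn_gt0// mulr_gt0// ltr0n.
have h1 : 0 < 128 * (C ^+ 2 * (t - s)) / (rho / 4) ^+ 2.
  by apply: h128; [exact: mulr_gt0|exact: divr_gt0].
apply: addr_gt0 => //; apply: addr_gt0 => //; apply: h128; last exact: divr_gt0.
by apply: mulr_gt0 => //; exact: mulr_gt0.
Qed.

Let Z (w : Omega) : R := X s w + sigma (X s w) * (W t w - W s w).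

Let s0T : 0 <= s <= T.
Proof. by rewrite ltW// (le_trans (ltW st)). Qed.

Let t0T : 0 <= t <= T.
Proof. by rewrite tT (le_trans (ltW s0))// ltW. Qed.

Let stays_le w : stays X N t w -> stays X N s w.
Proof.
by move=> h q /andP[q0 qs]; apply: h; rewrite q0 (le_trans qs)// ltW.
Qed.

(** If [psi (X s)] is non-zero then [|X s| <= N - 1], and without an excursion the path stays below
    [N] up to [t], so the indicator does not change. If it is zero, the weight at [t] is at most
    [psi (X t)], which is small by the Lipschitz property. *)
Let weight_increment w : {within `[0, T], continuous (fun r => X r w)} ->
  ~ excursion X N s t rho w -> `|weight t w - weight s w| <= Lpsi * rho.
Proof.
move=> cX ne; rewrite /weight !indicE.
have [ws|nws] := pselect (stays X N s w); last first.
  rewrite !memNset//; last by move/stays_le.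
  by rewrite !mulr0 subrr normr0 mulr_ge0// ltW.
rewrite (mem_set ws) mulr1.
have cX' : {within `[0, T], continuous (fun r => X r w - X s w)}.
  by move=> r; apply: cvgB; [exact: cX|exact: cvg_cst].
have Xq q : s <= ratr q <= t -> `|X (ratr q) w - X s w| <= rho.
  move=> qst; rewrite leNgt; apply/negP => h; apply: ne; split => //.
  by exists q.
have Xt : `|X t w - X s w| <= rho.
  by apply: (within_itv_rat_le cX' (ltW s0) st tT Xq); rewrite lexx ltW.
have XsN : `|X s w| <= N.
  apply: (within_itv_rat_le cX (lexx 0) s0 _ ws); last by rewrite lexx ltW.
  by case/andP: s0T.
have XsN1 : `|X s w| <= N + 1 by rewrite (le_trans XsN)// lerDl.
have XtN1 : `|X t w| <= N + 1.
  have := ler_normD (X t w - X s w) (X s w); rewrite subrK.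
  by move: Xt XsN rho1; lra.
have dpsi : `|psi (X t w) - psi (X s w)| <= Lpsi * rho.
  by apply: (le_trans (psi_lip XtN1 XsN1)); rewrite ler_wpM2l.
have [ps0|ps0] := eqVneq (psi (X s w)) 0.
  rewrite ps0 subr0 in dpsi; rewrite ps0 subr0.
  case: (w \in _); rewrite ?mulr1//.
  by rewrite mulr0 normr0 mulr_ge0// ltW.
rewrite mem_set ?mulr1// => q /andP[q0 qt].
have [qs|sq] := leP (ratr q) s; first by apply: ws; rewrite q0.
have [XsN' _] := psi_supp ps0.
have := Xq q; rewrite (ltW sq) qt => /(_ isT).
have := ler_normD (X (ratr q) w - X s w) (X s w); rewrite subrK.
by move: XsN' rho1; lra.
Qed.

Let bad_cover : exists B, [/\ measurable B, (P B <= (2 * p)%:E)%E &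
  forall w, ~ B w -> `|weight t w - weight s w| <= Lpsi * rho /\
    (stays X N s w -> `|X t w - Z w| <= a)].
Proof.
pose cont w := {within `[0, T], continuous (fun r => X r w)}.
have cX : {ae P, forall w, cont w} by case: X_solution.
set euler := [set w | stays X N s w /\
     (a < `|X t w - X s w - sigma (X s w) * (W t w - W s w)|)%R].
(* Doubling [p > 0] provides the strict inequality needed for a measurable cover. *)
have [|B [mB AB PB]] := @mu_ext_lt_cover _ _ _ P
    ([set w | ~ cont w] `|` (excursion X N s t rho `|` euler)) (2 * p)%:E.
  apply: (@le_lt_trans _ _ p%:E); last by rewrite lte_fin; move: p0; lra.
  apply: (le_trans (mu_extU _ _ _)); rewrite (mu_ext_negligible cX) add0e.
  apply: (le_trans (mu_extU _ _ _)); rewrite /p EFinD; apply: leeD.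
    exact: (mu_ext_excursion F_filtration W_brownian X_solution C0).
  exact: (mu_ext_euler F_filtration W_brownian X_solution).
exists B; split => // w nB.
have /not_orP[/contrapT cw /not_orP[nex neu]] : ~ ([set w | ~ cont w] `|`
  (excursion X N s t rho `|` euler)) w.
  by move=> /AB.
split; first exact: weight_increment.
move=> ws; rewrite leNgt; apply/negP => h; apply: neu; split => //.
by move: h; rewrite /Z opprD addrA.
Qed.

Variable (G : R -> R).
Hypotheses (G_itv : forall y, 0 <= G y <= 1)
  (G_lip : forall y z, `|G y - G z| <= `|y - z| / eta).

Let mG : measurable_fun [set: R] G.
Proof.
apply: continuous_measurable_fun => y; apply/cvgrPdist_lt => e e0.
apply/nbhs_ballP; exists (e * eta) => [|z yz] /=; first exact: mulr_gt0.
by apply: (le_lt_trans (G_lip _ _)); rewrite ltr_pdivrMr.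
Qed.

(** The price, outside the bad event, of passing from ([weight t], [X t]) to ([weight s], [Z]): the
    weight moves by [Lpsi * rho], and the test function of slope [1 / eta] by [a / eta]. *)
Let e1 : R := Lpsi * rho + Bpsi * (a / eta).

Let Bpsi0 : 0 <= Bpsi.
Proof. by have /andP[] := psi_itv 0; exact: le_trans. Qed.

Let e10 : 0 <= e1.
Proof.
by rewrite addr_ge0// mulr_ge0// ?divr_ge0// ltW.
Qed.

Let swap_le (v v' y y' : R) : 0 <= v <= Bpsi -> 0 <= v' <= Bpsi ->
  `|v - v'| <= Lpsi * rho -> (v = 0 \/ `|y - y'| <= a) -> 
  v * G y <= v' * G y' + e1.
Proof.
move=> /andP[v0 vB] /andP[v'0 v'B] vv' yy'.
have /andP[G0 G1] := G_itv y; have /andP[G'0 G'1] := G_itv y'.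
case: yy' => [->|yy']; first by rewrite mul0r addr_ge0// mulr_ge0.
have GG : G y <= G y' + a / eta.
  have h : `|y - y'| / eta <= a / eta by rewrite ler_pM2r// invr_gt0.
  have := le_trans (G_lip y y') h.
  by move=> /(le_trans (ler_norm _)); lra.
have vle : v <= v' + Lpsi * rho.
  by move: vv' => /(le_trans (ler_norm _)); lra.
have h1 : v * G y <= (v' + Lpsi * rho) * G y by rewrite ler_wpM2r.
have h2 : v' * G y <= v' * (G y' + a / eta) by rewrite ler_wpM2l.
have h3 : v' * (a / eta) <= Bpsi * (a / eta).
  by rewrite ler_wpM2r// divr_ge0// ltW.
have h4 : Lpsi * rho * G y <= Lpsi * rho.
  by rewrite ler_piMr// mulr_ge0// ltW.
apply: (le_trans h1); rewrite mulrDl /e1 [leRHS]addrCA [leRHS]addrC.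
apply: lerD => //; apply: (le_trans h2); rewrite mulrDr.
by rewrite lerD2l.
Qed.

Variable k : R.
Let err : R := (k / delta) ^+ 2 / (t - s) + 5 * (`|k| / delta) / Num.sqrt (t - s).

Let err0 : 0 <= err.
Proof.
apply: addr_ge0; apply: divr_ge0; rewrite ?sqr_ge0 ?sqrtr_ge0//.
  by rewrite subr_ge0 ltW.
by rewrite mulr_ge0// divr_ge0// ltW.
Qed.

(** Shifting [y + sigma y * z] by [k] amounts to shifting [z] by [k / sigma y]. Non-degeneracy of
    [sigma] enters here: where [v] does not vanish, this shift is at most [|k| / delta]. *)
Let gaussian_swap (y v : R) : 0 <= v <= Bpsi -> (v != 0 -> delta <= `|sigma y|) ->
  (\int[normal_prob 0 (Num.sqrt (t - s))]_z (v * G (y + sigma y * z))%:E <=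
   \int[normal_prob 0 (Num.sqrt (t - s))]_z (v * G (y + sigma y * z + k))%:E
   + (Bpsi * err)%:E)%E.
Proof.
move=> /andP[v0 vB] vsig.
have G0 z : 0 <= G z by have /andP[] := G_itv z.
have ts : 0 < Num.sqrt (t - s) by rewrite sqrtr_gt0 subr_gt0.
have mgk (c : R) : measurable_fun [set: R] (fun z : R => G (y + sigma y * z + c)).
  apply: (measurableT_comp mG); apply: measurable_funD => //.
  by apply: measurable_funD => //; exact: measurable_funM.
have mg : measurable_fun [set: R] (fun z : R => G (y + sigma y * z)).
  by have := mgk 0; under eq_fun do rewrite addr0.
have [->|vn0] := eqVneq v 0.
  under eq_integral do rewrite mul0r.
  by rewrite integral0 adde_ge0 ?lee_fin ?mulr_ge0//; apply: integral_ge0 => z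
    _; rewrite mul0r.
have sd := vsig vn0.
have sn0 : sigma y != 0.
  by apply/eqP => sE; move: sd; rewrite sE normr0 leNgt delta0.
have H := @normal_shift_le R (Num.sqrt (t - s)) (k / sigma y) (fun z => G (y +
  sigma y * z)) ts mg
  (fun z => G_itv _).
have shiftE z : y + sigma y * (z + k / sigma y) = y + sigma y * z + k.
  by rewrite mulrDr mulrCA divff// mulr1 addrA.
have {}H : (\int[normal_prob 0 (Num.sqrt (t - s))]_z (G (y + sigma y * z))%:E <=
   \int[normal_prob 0 (Num.sqrt (t - s))]_z (G (y + sigma y * z + k))%:E
   + err%:E)%E.
  under [X in (_ <= X + _)%E]eq_integral do rewrite -shiftE.
  apply: (le_trans H); rewrite leeD2l// lee_fin /err sqr_sqrtr ?subr_ge0 ?(ltW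
    st)//.
  have ks : `|k / sigma y| <= `|k| / delta.
    by rewrite normrM normfV ler_wpM2l// lef_pV2// posrE normr_gt0.
  apply: lerD.
    rewrite ler_wpM2r ?invr_ge0 ?subr_ge0 ?(ltW st)//.
    rewrite -real_normK ?num_real// -[leRHS]real_normK ?num_real//.
    rewrite ler_pXn2r ?nnegrE// (le_trans ks)// normrM normfV.
    by rewrite (gtr0_norm delta0).
  by rewrite ler_wpM2r ?invr_ge0 ?sqrtr_ge0// ler_wpM2l.
under eq_integral do rewrite EFinM.
rewrite ge0_integralZl//; last 2 first.
- exact/measurable_EFinP.
- by move=> z _; rewrite lee_fin.
under [X in (_ <= X + _)%E]eq_integral do rewrite EFinM.
rewrite ge0_integralZl//; last 2 first.
- by apply/measurable_EFinP; exact: mgk.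
- by move=> z _; rewrite lee_fin.
apply: (@le_trans _ _ (v%:E * (\int[normal_prob 0 (Num.sqrt (t - s))]_z (G (y +
  sigma y * z + k))%:E
   + err%:E))%E); first by rewrite lee_wpmul2l ?lee_fin.
rewrite ge0_muleDr ?lee_fin//; last by apply: integral_ge0 => z _; rewrite
  lee_fin.
by rewrite leeD2l// -EFinM lee_fin ler_wpM2r.
Qed.

Let compare_off (B : set Omega) (f1 f2 : Omega -> R) :
  measurable B -> (P B <= (2 * p)%:E)%E ->
  measurable_fun [set: Omega] f1 -> measurable_fun [set: Omega] f2 ->
  (forall w, 0 <= f1 w <= Bpsi) -> (forall w, 0 <= f2 w) ->
  (forall w, ~ B w -> f1 w <= f2 w + e1) ->
  (\int[P]_w (f1 w)%:E <= \int[P]_w (f2 w)%:E + (e1 + Bpsi * (2 * p))%:E)%E.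
Proof.
move=> mB PB m1 m2 f1B f20 f12.
apply: (@le_trans _ _ (\int[P]_w ((f2 w)%:E + (e1%:E + Bpsi%:E * (\1_B
  w)%:E)))%E).
  apply: ge0_le_integral => //.
  - by move=> w _; rewrite lee_fin; case/andP: (f1B w).
  - exact/measurable_EFinP.
  - apply: emeasurable_funD; first exact/measurable_EFinP.
    apply: emeasurable_funD => //; apply: emeasurable_funM => //.
    exact/measurable_EFinP/measurable_indic.
  move=> w _; rewrite -EFinM -!EFinD lee_fin indicE.
  have [Bw|nBw] := pselect (B w).
    rewrite mem_set// mulr1; have /andP[_ fB] := f1B w.
    have := f20 w; move: e10; lra.
  by rewrite memNset// mulr0 addr0; exact: f12.
rewrite ge0_integralD//; last 4 first.
- by move=> w _; rewrite lee_fin.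
- exact/measurable_EFinP.
- by move=> w _; rewrite -EFinM -EFinD lee_fin addr_ge0// mulr_ge0.
- apply: emeasurable_funD => //; apply: emeasurable_funM => //.
  exact/measurable_EFinP/measurable_indic.
rewrite leeD2l//.
have mI : measurable_fun [set: Omega] (fun w => (\1_B w)%:E : \bar R).
  exact/measurable_EFinP/measurable_indic.
rewrite (_ : (\int[P]_w (e1%:E + Bpsi%:E * (\1_B w)%:E))%E =
             (\int[P]_w (cst e1%:E w + Bpsi%:E * (\1_B w)%:E))%E)//.
rewrite ge0_integralD//; last 2 first.
- by move=> w _; rewrite -EFinM lee_fin mulr_ge0.
- exact: emeasurable_funM.
rewrite integral_cst// [X in (_ * X + _)%E]probability_setT mule1.
rewrite ge0_integralZl//.
rewrite integral_indic// setIT (EFinD e1) leeD2l// EFinM.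
by rewrite lee_wpmul2l// lee_fin.
Qed.

Let weight0 r w : 0 <= weight r w.
Proof. by have /andP[] := weight_itv r w. Qed.

Let mZ : measurable_fun [set: Omega] Z.
Proof.
apply: measurable_funD; first exact: (measurable_solution F_filtration
  X_solution).
apply: measurable_funM.
  apply: measurableT_comp => //.
  exact: (measurable_solution F_filtration X_solution).
by apply: measurable_funB; exact: (measurable_brownian F_filtration W_brownian).
Qed.

Let mwG r (Y : Omega -> R) : 0 <= r <= T -> measurable_fun [set: Omega] Y ->
  measurable_fun [set: Omega] (fun w => weight r w * G (Y w)).
Proof.
move=> rT mY; apply: measurable_funM; first exact: measurable_weight.
exact: (measurableT_comp mG).
Qed.

Let wG_itv r w y : 0 <= weight r w * G y <= Bpsi.
Proof.
have /andP[w0 wB] := weight_itv r w; have /andP[G0 G1] := G_itv y.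
by rewrite mulr_ge0//= (le_trans _ wB)// ler_piMr.
Qed.

(** The absolute value makes the integrand non-negative on the whole space, as Tonelli requires; it
    changes nothing on the weight itself. *)
Let measurable_Phi (c : R) : measurable_fun [set: (R * R) * R]
  (fun q => (`|q.1.1| * G (q.1.2 + sigma q.1.2 * q.2 + c))%:E : \bar R).
Proof.
apply/measurable_EFinP; apply: measurable_funM.
  by apply: measurableT_comp => //; exact: measurableT_comp.
apply: (measurableT_comp mG); apply: measurable_funD => //.
apply: measurable_funD; first exact: measurableT_comp.
apply: measurable_funM => //; apply: (measurableT_comp sigma_meas).
exact: measurableT_comp.
Qed.

Let expectation_Z (c : R) :
  (\int[P]_w (weight s w * G (Z w + c))%:E =
   \int[P]_w \int[normal_prob 0 (Num.sqrt (t - s))]_z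
     (weight s w * G (X s w + sigma (X s w) * z + c))%:E)%E.
Proof.
pose Phi (q : (R * R) * R) : \bar R :=
  (`|q.1.1| * G (q.1.2 + sigma q.1.2 * q.2 + c))%:E.
have mPhi := measurable_Phi c.
have Phi0 q : (0 <= Phi q)%E.
  by rewrite lee_fin mulr_ge0//; case/andP: (G_itv (q.1.2 + sigma q.1.2 * q.2 +
    c)).
have mY : mfun_wrt (F s) (fun w => (weight s w, X s w)).
  apply: measurable_fun_pair; first exact: mfun_wrt_weight.
  exact: (mfun_wrt_solution X_solution).
have := ge0_expectation_increment F_filtration W_brownian (ltW s0) st tT mY
  mPhi Phi0.
rewrite /Phi/=.
under eq_integral do rewrite ger0_norm//.
move=> ->; apply: eq_integral => w _; apply: eq_integral => z _.
by rewrite ger0_norm.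
Qed.

(** The pair ([weight t], [X t]) is exchanged for ([weight s], [Z]), where the Gaussian shift
    applies conditionally on time [s], and then exchanged back; each exchange costs [e1] plus [Bpsi]
    times the probability of the bad event. *)
Lemma expectation_shift_le :
  (\int[P]_w (weight t w * G (X t w))%:E <=
   \int[P]_w (weight t w * G (X t w + k))%:E +
   (Bpsi * err + 2 * (e1 + Bpsi * (2 * p)))%:E)%E.
Proof.
have [B [mB PB HB]] := bad_cover.
have mXt := measurable_solution F_filtration X_solution t0T.
have mXtk : measurable_fun [set: Omega] (fun w => X t w + k).
  exact: measurable_funD.
have mZk : measurable_fun [set: Omega] (fun w => Z w + k).
  exact: measurable_funD.
have off w : ~ B w -> weight t w = 0 /\ weight s w = 0 \/ `|X t w - Z w| <= a.
  move=> /HB[_ H]; have [ws|nws] := pselect (stays X N s w); first by right;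
    exact: H.
  by left; rewrite /weight !indicE !memNset// ?mulr0//; move/stays_le.
apply: (@le_trans _ _ (\int[P]_w (weight s w * G (Z w))%:E + (e1 + Bpsi * (2 *
  p))%:E)%E).
  apply: (compare_off mB PB); [exact: mwG|exact: mwG|by []| |].
    by move=> w; case/andP: (wG_itv s w (Z w)).
  move=> w nB; apply: swap_le; rewrite ?weight_itv//; first by have [] := HB w nB.
  by case: (off w nB) => [[]|]; [left|right].
have -> : (Bpsi * err + 2 * (e1 + Bpsi * (2 * p)) =
    (e1 + Bpsi * (2 * p)) + Bpsi * err + (e1 + Bpsi * (2 * p)))%R by ring.
rewrite (EFinD (e1 + Bpsi * (2 * p) + Bpsi * err) (e1 + Bpsi * (2 * p))) addeA.
apply: leeD2r; apply: (@le_trans _ _ (\int[P]_w (weight s w * G (Z w + k))%:E +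
  (Bpsi * err)%:E)%E); last first.
  rewrite (EFinD (e1 + Bpsi * (2 * p)) (Bpsi * err)) addeA; apply: leeD2r.
  apply: (compare_off mB PB); [exact: mwG|exact: mwG|by []| |].
    by move=> w; case/andP: (wG_itv t w (X t w + k)).
  move=> w nB; apply: swap_le; rewrite ?weight_itv//.
    by rewrite distrC; have [] := HB w nB.
  case: (off w nB) => [[]|h]; [by left|right].
  by rewrite opprD addrACA subrr addr0 distrC.
have := expectation_Z 0; under eq_integral do rewrite addr0.
move=> ->; rewrite expectation_Z.
set nu := normal_prob 0 _.
have mY : measurable_fun [set: Omega] (fun w => (weight s w, X s w)).
  apply: measurable_fun_pair; first exact: measurable_weight.
  exact: (measurable_solution F_filtration X_solution).
have mJ (c : R) : measurable_fun [set: Omega] (fun w => \int[nu]_z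
     (weight s w * G (X s w + sigma (X s w) * z + c))%:E)%E.
  pose Psi (q : (R * R) * R) : \bar R :=
    (`|q.1.1| * G (q.1.2 + sigma q.1.2 * q.2 + c))%:E.
  have mPsi := measurable_Phi c.
  have Psi0 q : (0 <= Psi q)%E.
    by rewrite lee_fin mulr_ge0//; case/andP: (G_itv (q.1.2 + sigma q.1.2 * q.2
      + c)).
  have := measurableT_comp (measurable_fun_fubini_tonelli_F (m2 := nu) Psi mPsi
    Psi0) mY.
  apply: eq_measurable_fun => w _; apply: eq_integral => z _.
  by rewrite /Psi/= ger0_norm.
have J0 (c : R) w : (0 <= \int[nu]_z
     (weight s w * G (X s w + sigma (X s w) * z + c))%:E)%E.
  by apply: integral_ge0 => z _; rewrite lee_fin; case/andP: (wG_itv s w (X s w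
    + sigma (X s w) * z + c)).
apply: (@le_trans _ _ (\int[P]_w (\int[nu]_z
     (weight s w * G (X s w + sigma (X s w) * z + k))%:E + cst (Bpsi * err)%:E
       w))%E).
  apply: ge0_le_integral => //.
  - exact: emeasurable_funD.
  move=> w _; under eq_integral do rewrite addr0.
  apply: gaussian_swap; first exact: weight_itv.
  rewrite /weight; case: (eqVneq (psi (X s w)) 0) => [->|/psi_supp[]//].
  by rewrite mul0r eqxx.
rewrite ge0_integralD//; last by move=> w _; rewrite lee_fin mulr_ge0.
by rewrite integral_cst// [X in (_ + _ * X)%E]probability_setT mule1.
Qed.

End key_estimate.

(** * A criterion for absolute continuity *)

Section density_criterion.
Context {R : realType} {d : measure_display} {Omega : measurableType d}.
Variables (P : probability Omega R) (v Y : Omega -> R) (B K h0 : R).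
Hypotheses (mv : measurable_fun [set: Omega] v)
  (mY : measurable_fun [set: Omega] Y)
  (v_itv : forall w, 0 <= v w <= B) (K0 : 0 <= K) (h00 : 0 < h0)
  (v_shift : forall (h : R) (G : R -> R) (k : R), 0 < h -> h <= h0 ->
    (forall y, 0 <= G y <= 1) ->
    (forall y z, `|G y - G z| <= `|y - z| / h ^+ 5) -> `|k| <= 32 * h ^+ 5 ->
    (\int[P]_w (v w * G (Y w))%:E <=
     \int[P]_w (v w * G (Y w + k))%:E + (K * h)%:E)%E).

Section moving_average.
Variables (Gam : R -> R) (u : R).
Hypotheses (Gam_incr : forall x y, x <= y -> 0 <= Gam y - Gam x <= y - x)
  (Gam_u : forall x y, x <= y -> Gam y - Gam x <= u).

(** [Gam] stands for the distribution function of Lebesgue measure restricted to an open set of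
    measure at most [u], so [avg eta x] is the proportion of []x, x + eta]] that the set fills. *)
Let avg (eta : R) (x : R) : R := (Gam (x + eta) - Gam x) / eta.

Let avg_itv eta x : 0 < eta -> 0 <= avg eta x <= 1.
Proof.
move=> eta0; have : x <= x + eta by rewrite lerDl ltW.
move=> /Gam_incr; rewrite addrAC subrr add0r => /andP[g0 g1].
by rewrite /avg divr_ge0 ?(ltW eta0)// ler_pdivrMr// mul1r.
Qed.

Let avg_lip eta x y : 0 < eta -> `|avg eta x - avg eta y| <= `|x - y| / eta.
Proof.
move=> eta0; wlog xy : x y / x <= y.
  move=> H; have [xy|/ltW yx] := leP x y; first exact: H.
  by rewrite distrC (distrC x); exact: H.
rewrite /avg -mulrBl normrM normfV (gtr0_norm eta0) ler_pM2r ?invr_gt0//.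
have /andP[a0 a1] := Gam_incr xy.
have : x + eta <= y + eta by rewrite lerD2r.
move=> /Gam_incr; rewrite opprD addrACA subrr addr0 => /andP[b0 b1].
by rewrite (distrC x) (@ger0_norm _ (y - x)) ?subr_ge0// ler_norml; lra.
Qed.

Let mavg eta : 0 < eta -> measurable_fun [set: R] (avg eta).
Proof.
move=> eta0; apply: continuous_measurable_fun => y.
apply/cvgrPdist_lt => e e0.
apply/nbhs_ballP; exists (e * eta) => [|z yz] /=; first exact: mulr_gt0.
by apply: (le_lt_trans (avg_lip _ _ eta0)); rewrite ltr_pdivrMr.
Qed.

Let E (f : R -> R) : \bar R := (\int[P]_w (v w * f (Y w))%:E)%E.

Let mvf (f : R -> R) : measurable_fun [set: R] f ->
  measurable_fun [set: Omega] (fun w => (v w * f (Y w))%:E : \bar R).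
Proof.
move=> mf; apply/measurable_EFinP; apply: measurable_funM => //.
exact: measurableT_comp.
Qed.

Let v0 w : 0 <= v w. Proof. by have /andP[] := v_itv w. Qed.

Let vB w : v w <= B. Proof. by have /andP[] := v_itv w. Qed.

Let B0 : 0 <= B. Proof. exact: le_trans (v0 point) (vB point). Qed.

Let E_le (f : R -> R) (c : R) : measurable_fun [set: R] f ->
  (forall x, 0 <= f x <= c) -> (0 <= E f <= (B * c)%:E)%E.
Proof.
move=> mf fc; apply/andP; split.
  by apply: integral_ge0 => w _; rewrite lee_fin mulr_ge0//; case/andP: (fc (Y
    w)).
apply: (@le_trans _ _ (\int[P]_w (cst (B * c)%:E w))%E).
  apply: ge0_le_integral => //.
  - by move=> w _; rewrite lee_fin mulr_ge0//; case/andP: (fc (Y w)).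
  - exact: mvf.
  - by move=> w _; rewrite lee_fin; case/andP: (fc (Y w)) => ? ?; exact: ler_pM.
by rewrite integral_cst// [X in (_ * X)%E]probability_setT mule1.
Qed.

Let avg_double eta x : 0 < eta ->
  avg (2 * eta) x = (avg eta x + avg eta (x + eta)) / 2.
Proof.
move=> eta0; rewrite /avg (_ : x + 2 * eta = x + eta + eta); last by ring.
by field; rewrite gt_eqF.
Qed.

(** [avg (2 * eta)] is the mean of [avg eta] and its translate by [eta], and [v_shift] with [k]
    equal to [eta] compares these two. *)
Let E_double h eta : 0 < h -> h <= h0 -> h ^+ 5 <= eta -> eta <= 32 * h ^+ 5 ->
  (E (avg eta) <= E (avg (2 * eta)) + (K * h)%:E)%E.
Proof.
move=> hp hh heta etah; have h5 : 0 < h ^+ 5 by rewrite exprn_gt0.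
have eta0 : 0 < eta by exact: lt_le_trans heta.
have lip y z : `|avg eta y - avg eta z| <= `|y - z| / h ^+ 5.
  apply: (le_trans (avg_lip _ _ eta0)).
  by rewrite ler_wpM2l// lef_pV2// posrE.
have etak : `|eta| <= 32 * h ^+ 5 by rewrite gtr0_norm.
have := v_shift hp hh (fun y => avg_itv y eta0) lip etak.
have ms : measurable_fun [set: R] (fun y => avg eta (y + eta)).
  by apply: (measurableT_comp (mavg eta0)); exact: measurable_funD.
have i1 := E_le (mavg eta0) (fun y => avg_itv y eta0).
have i2 := E_le ms (fun y => avg_itv (y + eta) eta0).
have e2 : 0 < 2 * eta by rewrite mulr_gt0.
have i3 := E_le (mavg e2) (fun y => avg_itv y e2).
rewrite -/(E _) -/(E (fun y => avg eta (y + eta))).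
have : (2%:E * E (avg (2 * eta)) = E (avg eta) + E (fun y => avg eta (y +
  eta)))%E.
  rewrite /E -ge0_integralD//; last 4 first.
  - by move=> w _; rewrite lee_fin mulr_ge0//; case/andP: (avg_itv (Y w) eta0).
  - exact: (mvf (mavg eta0)).
  - by move=> w _; rewrite lee_fin mulr_ge0//; case/andP: (avg_itv (Y w + eta)
      eta0).
  - exact: (mvf ms).
  rewrite -ge0_integralZl//; last 2 first.
  - exact: (mvf (mavg e2)).
  - by move=> w _; rewrite lee_fin mulr_ge0//; case/andP: (avg_itv (Y w) e2).
  apply: eq_integral => w _; rewrite -EFinM -EFinD avg_double//.
  by congr EFin; field.
have fin (z : \bar R) : (0 <= z <= (B * 1)%:E)%E -> exists r, z = r%:E.
  by case: z => [r _|/andP[]//|/andP[]//]; exists r.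
have [[r1 ->] [r2 ->] [r3 ->]] := And3 (fin _ i1) (fin _ i2) (fin _ i3).
rewrite -EFinM -!EFinD => -[e]; rewrite !lee_fin.
have : 0 <= K * h by rewrite mulr_ge0// ltW.
lra.
Qed.

(** Doubling [h] multiplies [h ^+ 5] by 32, that is, by five doublings, each paid at the same price
    [K * h]. *)
Let E_32 h : 0 < h -> 2 * h <= h0 ->
  (E (avg (h ^+ 5)) <= E (avg ((2 * h) ^+ 5)) + (5 * (K * h))%:E)%E.
Proof.
move=> hp hh; have h5 : 0 < h ^+ 5 by rewrite exprn_gt0.
have hh0 : h <= h0 by move: hh; lra.
have step c : 1 <= c <= 16 ->
    (E (avg (c * h ^+ 5)) <= E (avg ((2 * c) * h ^+ 5)) + (K * h)%:E)%E.
  move=> /andP[c1 c2]; rewrite -mulrA; apply: E_double => //.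
  - by rewrite ler_peMl// ltW.
  - by rewrite ler_pM2r//; lra.
have c32 : (2 * h) ^+ 5 = 2 * (2 * (2 * (2 * (2 * 1)))) * h ^+ 5 by ring.
have s1 := step 1; have s2 := step (2 * 1); have s3 := step (2 * (2 * 1)).
have s4 := step (2 * (2 * (2 * 1))); have s5 := step (2 * (2 * (2 * (2 * 1)))).
rewrite c32 -{1}(mul1r (h ^+ 5)).
have -> : ((5 * (K * h))%:E = (K * h)%:E + (K * h)%:E + (K * h)%:E + (K * h)%:E
  + (K * h)%:E :> \bar R)%E.
  by rewrite -!EFinD; congr EFin; ring.
rewrite !addeA.
apply: (le_trans (s1 _)); first by lra.
apply: leeD2r; apply: (le_trans (s2 _)); first by lra.
apply: leeD2r; apply: (le_trans (s3 _)); first by lra.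
apply: leeD2r; apply: (le_trans (s4 _)); first by lra.
by apply: leeD2r; apply: s5; lra.
Qed.

(** The prices [5 * K * h / 2 ^+ i] for [i] from 1 to [n] form a geometric series, so the total
    stays below [5 * K * h] for every [n]. *)
Let E_scale h n : 0 < h -> h <= h0 ->
  (E (avg ((h / 2 ^+ n) ^+ 5)) <=
   E (avg (h ^+ 5)) + (5 * K * (h - h / 2 ^+ n))%:E)%E.
Proof.
move=> hp hh; elim: n => [|n ih].
  by rewrite expr0 divr1 subrr mulr0 adde0.
set e := h / 2 ^+ n.+1.
have e0 : 0 < e by rewrite divr_gt0// exprn_gt0.
have e2 : h / 2 ^+ n = 2 * e by rewrite /e exprS; field; rewrite expf_neq0.
have e2h : 2 * e <= h0.
  rewrite -e2 (le_trans _ hh)// ler_pdivrMr ?exprn_gt0//.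
  by rewrite -[leLHS]mulr1 ler_pM2l// exprn_ege1// ler1n.
apply: (le_trans (E_32 e0 e2h)); rewrite -e2.
apply: (le_trans (leeD2r _ ih)); rewrite -addeA -EFinD leeD2l// lee_fin e2.
by rewrite le_eqVlt; apply/orP; left; apply/eqP; ring.
Qed.

Lemma expectation_average_le h n : 0 < h -> h <= h0 ->
  (\int[P]_w (v w * ((Gam (Y w + (h / 2 ^+ n) ^+ 5) - Gam (Y w)) / (h / 2 ^+ n)
    ^+ 5))%:E
   <= (B * (u / h ^+ 5) + 5 * K * h)%:E)%E.
Proof.
move=> hp hh; have h5 : 0 < h ^+ 5 by rewrite exprn_gt0.
apply: (le_trans (E_scale n hp hh)); rewrite EFinD; apply: leeD.
  have /andP[_] : (0 <= E (avg (h ^+ 5)) <= (B * (u / h ^+ 5))%:E)%E; last by [].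
  apply: E_le; first exact: mavg.
  move=> y; have /andP[-> _] := avg_itv y h5.
  by rewrite /= /avg ler_pM2r ?invr_gt0// Gam_u// lerDl ltW.
rewrite lee_fin ler_wpM2l ?mulr_ge0// gerBl divr_ge0// ?ltW// exprn_gt0//.
Qed.

End moving_average.

(** At a point of an open set the averages are eventually equal to 1, so the uniform bound on
    averages passes to the indicator by dominated convergence. *)
Let expectation_open_le (U : set R) (u h : R) : open U ->
  (lebesgue_measure U <= u%:E)%E -> 0 < h -> h <= h0 ->
  (\int[P]_w (v w * \1_U (Y w))%:E <= (B * (u / h ^+ 5) + 5 * K * h)%:E)%E.
Proof.
move=> oU Uu hp hh.
have mU : measurable U by exact: open_measurable.
pose mu := @lebesgue_measure R.
pose Gam (z : R) : R := fine (mu (U `&` `]-oo, z]%classic)).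
have mI (i : interval R) : measurable (U `&` [set` i]).
  by apply: measurableI => //; exact: measurable_itv.
have leI (i : interval R) (V : set R) : measurable V ->
    U `&` [set` i] `<=` V -> (mu (U `&` [set` i]) <= mu V)%E.
  by move=> mV UV; apply: le_measure => //; rewrite inE//; exact: mI.
have finI (i : interval R) : mu (U `&` [set` i]) \is a fin_num.
  rewrite ge0_fin_numE//; apply: (@le_lt_trans _ _ u%:E); last by rewrite ltry.
  by apply: le_trans Uu; apply: leI => //; exact: subIsetl.
have GamE z y : z <= y -> Gam y - Gam z = fine (mu (U `&` `]z, y]%classic)).
  move=> zy; rewrite /Gam.
  have -> : U `&` `]-oo, y]%classic = (U `&` `]-oo, z]%classic) `|` (U `&` `]z,
    y]%classic).
    by rewrite -setIUr -itv_bndbnd_setU.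
  rewrite [mu (_ `|` _)]measureU; [|exact: mI|exact: mI|].
    by rewrite fineD// addrAC subrr add0r.
  rewrite setIACA setIid (_ : `]-oo, z]%classic `&` _ = set0) ?setI0//.
  apply/seteqP; split => r //= []; rewrite !in_itv/= => rz /andP[zr _].
  by move: zr; rewrite ltNge rz.
have Gam_incr z y : z <= y -> 0 <= Gam y - Gam z <= y - z.
  move=> zy; rewrite GamE// fine_ge0//= -lee_fin fineK//.
  apply: (@le_trans _ _ (mu `]z, y]%classic)).
    by apply: leI; [exact: measurable_itv|exact: subIsetr].
  rewrite /mu lebesgue_measure_itv/= lte_fin; case: ifP => // _.
  by rewrite lee_fin subr_ge0.
have Gam_u z y : z <= y -> Gam y - Gam z <= u.
  move=> zy; rewrite GamE// -lee_fin fineK//.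
  by apply: le_trans Uu; apply: leI => //; exact: subIsetl.
pose e (n : nat) : R := (h / 2 ^+ n) ^+ 5.
have e0 n : 0 < e n by rewrite exprn_gt0// divr_gt0// exprn_gt0.
pose avg n y := (Gam (y + e n) - Gam y) / e n.
have avg_itv n y : 0 <= avg n y <= 1.
  have : y <= y + e n by rewrite lerDl ltW.
  move=> /Gam_incr; rewrite addrAC subrr add0r => /andP[g0 g1].
  by rewrite /avg divr_ge0 ?(ltW (e0 n))// ler_pdivrMr// mul1r.
have mGam : measurable_fun [set: R] Gam.
  apply: nondecreasing_measurable => // z y zy.
  by rewrite -subr_ge0; case/andP: (Gam_incr _ _ zy).
have mavg n : measurable_fun [set: R] (avg n).
  apply: measurable_funM => //; apply: measurable_funB => //.
  by apply: measurableT_comp => //; exact: measurable_funD.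
have mUY : measurable_fun [set: Omega] (fun w => \1_U (Y w) : R).
  apply: (measurableT_comp _ mY); exact: measurable_indic.
have v0 w : 0 <= v w by have /andP[] := v_itv w.
have B0 : 0 <= B by have /andP[] := v_itv point; exact: le_trans.
have I01 w : 0 <= (\1_U (Y w) : R) <= 1.
  by rewrite indicE; case: (_ \in _); rewrite ?lexx ?ler01.
(* Outside [U] the averages need not tend to 0, for instance at a left endpoint of a component; the
   factor [\1_U] removes these points. *)
pose f n w : \bar R := (v w * (\1_U (Y w) * avg n (Y w)))%:E.
have mf n : measurable_fun [set: Omega] (f n).
  apply/measurable_EFinP; apply: measurable_funM => //.
  apply: measurable_funM => //; exact: measurableT_comp.
have fle n : (\int[P]_w f n w <= (B * (u / h ^+ 5) + 5 * K * h)%:E)%E.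
  apply: le_trans (expectation_average_le Gam_incr Gam_u n hp hh).
  apply: ge0_le_integral => //.
  - move=> w _; rewrite lee_fin mulr_ge0//; have /andP[? _] := I01 w.
    by have /andP[? _] := avg_itv n (Y w); rewrite mulr_ge0.
  - apply/measurable_EFinP; apply: measurable_funM => //.
    exact: (measurableT_comp (mavg n) mY).
  - move=> w _; rewrite lee_fin ler_wpM2l// ler_piMl//.
    by have /andP[] := avg_itv n (Y w).
have cvgf w : f n w @[n --> \oo] --> (v w * \1_U (Y w))%:E.
  apply: cvg_EFin; first by apply: nearW.
  have [UY|nUY] := pselect (U (Y w)); last first.
    rewrite indicE memNset// mulr0; apply: cvg_near_cst; apply: nearW => n.
    by rewrite /f /= indicE memNset// mul0r mulr0.
  have /open_nbhs_nbhs : open_nbhs (Y w) U by [].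
  move=> /nbhs_ballP[r /= r0 rU].
  apply: cvg_near_cst.
  (* Below 1 a fifth power is at most its base, so it suffices to make [h / 2 ^+ n] itself small,
     which [n < 2 ^ n] ensures. *)
  have r1 : 0 < Num.min r 1 by rewrite lt_min r0 ltr01.
  have hr0 : 0 <= h / Num.min r 1 by rewrite divr_ge0// ltW.
  have := archi_boundP hr0; set n0 := Num.bound _ => hn0.
  exists n0 => // n /= n0n.
  have en : e n < Num.min r 1.
    have h2 : h / 2 ^+ n < Num.min r 1.
      rewrite ltr_pdivrMr ?exprn_gt0// mulrC -ltr_pdivrMr//.
      apply: (lt_le_trans hn0); rewrite -natrX ler_nat.
      by rewrite (leq_trans n0n)// ltnW// ltn_expl.
    apply: (le_lt_trans _ h2); rewrite /e exprS ler_piMr ?divr_ge0 ?exprn_ge0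
      ?(ltW hp)//.
    rewrite exprn_ile1// ?divr_ge0 ?exprn_ge0 ?(ltW hp)//.
    by apply/ltW/(lt_le_trans h2); rewrite ge_min lexx orbT.
  rewrite /f /= indicE mem_set// mul1r; congr (_ * _).
  have ye : Y w <= Y w + e n by rewrite lerDl ltW.
  rewrite /avg GamE//.
  rewrite (_ : U `&` _ = `]Y w, (Y w + e n)]%classic); last first.
    apply/seteqP; split => z /=; first by case.
    rewrite in_itv/= => /andP[z1 z2]; rewrite z1 z2; split => //; apply: rU.
    rewrite /ball/= ltr_distlC; have : e n < r by apply: (lt_le_trans en);
      rewrite ge_min lexx.
    by move: r0; lra.
  rewrite /mu lebesgue_measure_itv/= lte_fin ltrDl e0/= addrAC subrr add0r.
  by rewrite divff// gt_eqF.
have mlim : measurable_fun [set: Omega] (fun w => (v w * \1_U (Y w))%:E : \bar R).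
  by apply/measurable_EFinP; exact: measurable_funM.
have intB : P.-integrable setT (cst B%:E : Omega -> \bar R).
  exact: finite_measure_integrable_cst.
have fB w n : (`|f n w| <= B%:E)%E.
  rewrite /f /= lee_fin.
  have /andP[? ?] := I01 w; have /andP[? ?] := avg_itv n (Y w).
  have /andP[vw0 vwB] := v_itv w.
  rewrite ger0_norm; last by rewrite mulr_ge0// mulr_ge0.
  by apply: (le_trans _ vwB); rewrite ler_piMr// mulr_ile1.
have [_ _ H] := @dominated_convergence _ Omega R P setT measurableT f
  (fun w => (v w * \1_U (Y w))%:E) (cst B%:E) mf mlim (aeW _ (fun w _ => cvgf w))
  intB (aeW _ (fun w n _ => fB w n)).
by apply: (cvge_to_le H); apply: nearW => n; exact: fle.
Qed.

Lemma expectation_null_set (A : set R) : measurable A ->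
  lebesgue_measure A = 0%E -> (\int[P]_w (v w * \1_A (Y w))%:E = 0)%E.
Proof.
move=> mA A0.
have v0 w : 0 <= v w by have /andP[] := v_itv w.
have B0 : 0 <= B by have /andP[] := v_itv point; exact: le_trans.
have mIY (U : set R) : measurable U ->
    measurable_fun [set: Omega] (fun w => (v w * \1_U (Y w))%:E : \bar R).
  move=> mU; apply/measurable_EFinP; apply: measurable_funM => //.
  apply: (measurableT_comp _ mY); exact: measurable_indic.
have I0 (U : set R) w : (0 <= (v w * \1_U (Y w))%:E :> \bar R)%E.
  by rewrite lee_fin mulr_ge0.
apply/eqP; rewrite eq_le integral_ge0 ?andbT//.
have key h u : 0 < h -> h <= h0 -> 0 < u ->
    (\int[P]_w (v w * \1_A (Y w))%:E <= (B * (u / h ^+ 5) + 5 * K * h)%:E)%E.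
  move=> hp hh up.
  have A_fin : (lebesgue_measure A < +oo)%E by rewrite A0 ltry.
  have [U [oU AU Uu]] := lebesgue_regularity_outer mA A_fin up.
  have mU : measurable U by exact: open_measurable.
  have U_u : (lebesgue_measure U <= u%:E)%E.
    rewrite -(setDUK AU).
    apply: (le_trans (measureU2 lebesgue_measure mA (measurableD mU mA))).
    by rewrite [X in (X + _)%E]A0 add0e; exact: ltW.
  apply: le_trans (expectation_open_le oU U_u hp hh).
  apply: ge0_le_integral => //; [exact: mIY|exact: mIY|].
  move=> w _; rewrite lee_fin ler_wpM2l// !indicE ler_nat.
  have [Aw|nAw] := pselect (A (Y w)); last by rewrite memNset.
  by rewrite !mem_set//; exact: AU.
have key2 h : 0 < h -> h <= h0 ->
    (\int[P]_w (v w * \1_A (Y w))%:E <= ((1 + 5 * K) * h)%:E)%E.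
  move=> hp hh; have h5 : 0 < h ^+ 5 by rewrite exprn_gt0.
  have B1 : 0 < B + 1 by rewrite ltr_wpDl.
  (* The neighbourhood is chosen after [h], so small that [B * (u / h ^+ 5) <= h]; [B + 1] keeps the
     denominator positive. *)
  apply: (le_trans (key h (h ^+ 6 / (B + 1)) hp hh _)).
    by rewrite divr_gt0// exprn_gt0.
  rewrite lee_fin (mulrDl 1 (5 * K) h) mul1r lerD2r.
  have -> : B * (h ^+ 6 / (B + 1) / h ^+ 5) = h * (B / (B + 1)).
    by field; rewrite !gt_eqF.
  by rewrite ler_piMr ?(ltW hp)// ler_pdivrMr// mul1r lerDl.
apply/lee_addgt0Pr => r r0; rewrite add0e.
have K1 : 0 < 1 + 5 * K by rewrite ltr_wpDr// mulr_ge0.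
apply: (le_trans (key2 (Num.min h0 (r / (1 + 5 * K))) _ _)).
- by rewrite lt_min h00 divr_gt0.
- by rewrite ge_min lexx.
rewrite lee_fin mulrC -ler_pdivlMr//.
by rewrite ge_min lexx orbT.
Qed.

End density_criterion.

Lemma expectation_weight_null {R : realType} {d : measure_display}
  {Omega : measurableType d} (P : probability Omega R) (T : R)
  (F : R -> set (set Omega)) (W : R -> Omega -> R) (b : R -> R -> R)
  (sigma : R -> R) (x : R) (X : R -> Omega -> R) (N C : R)
  (psi : R -> R) (delta Bpsi Lpsi t : R) (A : set R) :
  filtration T F -> brownian_motion P T F W ->
  sde_solution P T F W b sigma x X -> measurable_fun [set: R] sigma ->
  0 < C ->
  (forall r y, 0 <= r <= T -> `|y| <= N + 1 -> `|b r y| <= C) ->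
  (forall y, `|y| <= N + 1 -> `|sigma y| <= C) ->
  (forall y z, `|y| <= N + 1 -> `|z| <= N + 1 ->
     `|sigma y - sigma z| <= C * `|y - z|) ->
  measurable_fun [set: R] psi -> 0 < delta ->
  (forall y, 0 <= psi y <= Bpsi) ->
  (forall y, psi y != 0 -> `|y| <= N - 1 /\ delta <= `|sigma y|) ->
  0 <= Lpsi ->
  (forall y z, `|y| <= N + 1 -> `|z| <= N + 1 ->
     `|psi y - psi z| <= Lpsi * `|y - z|) ->
  0 < t -> t <= T -> measurable A -> lebesgue_measure A = 0%E ->
  (\int[P]_w (weight X N psi t w * \1_A (X t w))%:E = 0)%E.
Proof.
move=> Ffil Wbm Xsol msig C0 b_le sig_le sig_lip mpsi delta0 psi_itv psi_supp
  L0 psi_lip t0 tT mA A0.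
have tT' : 0 <= t <= T by rewrite ltW.
have B0 : 0 <= Bpsi by have /andP[] := psi_itv 0; exact: le_trans.
pose kap := 32 / delta.
have kap0 : 0 <= kap by rewrite divr_ge0// ltW.
(* The probability bound [p] at these scales is exactly [p1 * h ^+ 2]. *)
pose p1 := 128 * C ^+ 2 / (1 / 4) ^+ 2 +
  (128 * C ^+ 2 / (1 / 4) ^+ 2 + 128 * C ^+ 2 / (1 / 2) ^+ 2).
have p10 : 0 <= p1.
  have q (z : R) : 0 <= 128 * C ^+ 2 / z ^+ 2.
    by rewrite divr_ge0 ?sqr_ge0// mulr_ge0 ?sqr_ge0// ler0n.
  by rewrite addr_ge0 ?addr_ge0.
(* The first summand pays for the Gaussian shift, where [kap * h ^+ 5] bounds [|k| / delta]; the
   doubled one pays for the two exchanges: weight, Euler error and bad event. *)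
pose K := Bpsi * (kap ^+ 2 + 5 * kap) + 2 * (Lpsi + Bpsi + Bpsi * (2 * p1)).
have K0 : 0 <= K.
  apply: addr_ge0; apply: mulr_ge0 => //.
    by rewrite addr_ge0 ?sqr_ge0// mulr_ge0.
  by rewrite addr_ge0 ?addr_ge0// mulr_ge0// mulr_ge0.
(* The three bounds give [h ^+ n.+1 <= h], a starting time [t - h ^+ 8 > 0], and [4 * C * h <= 1],
   which keeps the drift below the thresholds. *)
pose h0 := Num.min 1 (Num.min (t / 2) (1 / (4 * C))).
have h00 : 0 < h0 by rewrite !lt_min ltr01 !divr_gt0// mulr_gt0.
(* Scales: step h^8, excursion h^3, Euler error h^6, smoothing h^5. *)
apply: (@expectation_null_set _ _ _ P (weight X N psi t) (X t) Bpsi K h0) => //.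
- exact: (measurable_weight Ffil Xsol).
- exact: (measurable_solution Ffil Xsol).
- by move=> w; exact: weight_itv.
move=> h G k hp; rewrite !le_min => /andP[h1 /andP[ht hC]] G01 Glip kh.
have hpow n : h ^+ n.+1 <= h.
  by rewrite exprS ler_piMr ?(ltW hp)// exprn_ile1// ltW.
have hX n : 0 < h ^+ n by rewrite exprn_gt0.
have hn0 : h != 0 by rewrite gt_eqF.
have st : t - h ^+ 8 < t by rewrite ltrBlDr ltrDl.
have s0 : 0 < t - h ^+ 8.
  rewrite subr_gt0 (le_lt_trans (hpow 7))// (le_lt_trans ht)//.
  by rewrite ltr_pdivrMr// mulr_natr mulr2n ltrDl.
have ts : t - (t - h ^+ 8) = h ^+ 8 by ring.
have hC4 : 4 * C * h <= 1 by rewrite mulrC -ler_pdivlMr// mulr_gt0.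
have rhoC : 4 * C * (t - (t - h ^+ 8)) <= h ^+ 3.
  rewrite ts (_ : 4 * C * h ^+ 8 = (4 * C * h ^+ 5) * h ^+ 3); last by ring.
  rewrite ler_piMl ?(ltW (hX 3))// (le_trans _ hC4)// ler_pM2l ?mulr_gt0//.
have aC : 2 * C * (t - (t - h ^+ 8)) <= h ^+ 6.
  rewrite ts (_ : 2 * C * h ^+ 8 = (2 * C * h ^+ 2) * h ^+ 6); last by ring.
  rewrite ler_piMl ?(ltW (hX 6))// (le_trans _ hC4)//.
  apply: (@le_trans _ _ (2 * C * h)); first by rewrite ler_pM2l ?mulr_gt0.
  by rewrite ler_pM2r// ler_pM2r// ler_nat.
have rho1 : h ^+ 3 <= 1 by rewrite exprn_ile1// ltW.
apply: (le_trans (@expectation_shift_le _ _ _ _ _ _ _ _ _ _ _ Ffil Wbm Xsol msig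
  N C C0 b_le sig_le sig_lip psi delta Bpsi Lpsi mpsi delta0 psi_itv psi_supp L0
  psi_lip (t - h ^+ 8) t (h ^+ 3) (h ^+ 6) (h ^+ 5) s0 st tT (hX 3) rho1 rhoC
  (hX 6) aC (hX 5) G G01 Glip k)).
rewrite leeD2l// lee_fin ts.
have -> : Num.sqrt (h ^+ 8) = h ^+ 4.
  by rewrite (_ : h ^+ 8 = (h ^+ 4) ^+ 2) ?sqrtr_sqr ?ger0_norm ?ltW// -exprM.
have kd : `|k| / delta <= kap * h ^+ 5.
  by rewrite /kap mulrAC ler_pM2r ?invr_gt0.
have kd0 : 0 <= `|k| / delta by rewrite divr_ge0// ltW.
have t1 : (k / delta) ^+ 2 / h ^+ 8 <= kap ^+ 2 * h.
  rewrite ler_pdivrMr//.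
  have -> : (k / delta) ^+ 2 = (`|k| / delta) ^+ 2.
    by rewrite !exprMn real_normK ?num_real.
  apply: (@le_trans _ _ ((kap * h ^+ 5) ^+ 2)).
    by rewrite ler_pXn2r// nnegrE mulr_ge0// ltW.
  have -> : (kap * h ^+ 5) ^+ 2 = kap ^+ 2 * (h ^+ 2 * h ^+ 8) by ring.
  by rewrite -(mulrA (kap ^+ 2) h) ler_wpM2l ?sqr_ge0// ler_pM2r.
have t2 : 5 * (`|k| / delta) / h ^+ 4 <= 5 * kap * h.
  rewrite ler_pdivrMr//.
  have -> : 5 * kap * h * h ^+ 4 = 5 * (kap * h ^+ 5) by ring.
  by rewrite ler_pM2l.
have t3 : Lpsi * h ^+ 3 <= Lpsi * h by rewrite ler_wpM2l.
have t4 : h ^+ 6 / h ^+ 5 = h by field.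
set p := (128 * (C ^+ 2 * h ^+ 8) / _ + _).
have t5 : p <= p1 * h.
  have -> : p = p1 * h ^+ 2 by rewrite /p /p1; field.
  by rewrite ler_wpM2l.
have t6 : Bpsi * ((k / delta) ^+ 2 / h ^+ 8 + 5 * (`|k| / delta) / h ^+ 4) <=
    Bpsi * (kap ^+ 2 * h + 5 * kap * h).
  by rewrite ler_wpM2l// lerD.
have t7 : Bpsi * (2 * p) <= Bpsi * (2 * (p1 * h)) by rewrite ler_wpM2l// ler_pM2l.
rewrite t4.
have -> : K * h = Bpsi * (kap ^+ 2 * h + 5 * kap * h) +
    2 * (Lpsi * h + Bpsi * h + Bpsi * (2 * (p1 * h))) by rewrite /K; ring.
apply: lerD => //; rewrite ler_pM2l//; apply: lerD => //; exact: lerD.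
Qed.

(** * Localisation *)

Lemma continuous_path_bounded {R : realType} (f : R -> R) (T : R) : 0 <= T ->
  {within `[0, T], continuous f} ->
  exists M, forall r, 0 <= r <= T -> `|f r| <= M.
Proof.
move=> T0 cf; have cabs : {within `[0, T], continuous (fun r => `|f r|)}.
  by move=> r; apply: cvg_norm; exact: cf.
have [c _ H] := EVT_max T0 cabs; exists `|f c| => r rT; apply: H.
by rewrite in_itv.
Qed.

(** Moving the drift term of the monotonicity condition to the right and bounding it by the local
    Lipschitz property of [b] leaves [(p1 - 1) * |sigma y - sigma z| ^+ 2 <= L2 * |y - z| ^+ 2], and
    [p1 - 1 > 1]. The single time 0 suffices, as [sigma] does not depend on time. *)
Lemma local_bounds {R : realType} (T : R) (b : R -> R -> R) (sigma : R -> R)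
  (K p1 K' l M : R) : 0 <= T -> 0 < K -> 2 < p1 ->
  (forall s x y : R, 0 <= s <= T ->
     2 * (x - y) * (b s x - b s y) + (p1 - 1) * `|sigma x - sigma y| ^+ 2
       <= K * `|x - y| ^+ 2) ->
  0 < K' -> 0 < l ->
  (forall s x y : R, 0 <= s <= T ->
     `|b s x - b s y| <= K' * (1 + `|x| `^ l + `|y| `^ l) * `|x - y|) ->
  (forall s x : R, 0 <= s <= T -> `|b s x| <= K' * (1 + `|x| `^ (l + 1))) ->
  0 <= M ->
  exists C, [/\ 0 < C,
    forall r y, 0 <= r <= T -> `|y| <= M -> `|b r y| <= C,
    forall y, `|y| <= M -> `|sigma y| <= C &
    forall y z, `|y| <= M -> `|z| <= M -> `|sigma y - sigma z| <= C * `|y - z| ].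
Proof.
move=> T0 K0 p12 mono K'0 l0 blip bgrow M0.
have pow_le (y q : R) : 0 <= q -> `|y| <= M -> `|y| `^ q <= M `^ q.
  by move=> q0 yM; apply: ge0_ler_powR; rewrite ?nnegrE.
pose L2 := K + 2 * (K' * (1 + M `^ l + M `^ l)).
have pM0 : 0 <= K' * (1 + M `^ l + M `^ l).
  by rewrite mulr_ge0 ?(ltW K'0)// !addr_ge0// powR_ge0.
have L20 : 0 <= L2 by rewrite addr_ge0 ?(ltW K0)// mulr_ge0.
have lip y z : `|y| <= M -> `|z| <= M ->
    `|sigma y - sigma z| <= Num.sqrt L2 * `|y - z|.
  move=> yM zM; have T00 : (0 : R) <= 0 <= T by rewrite lexx.
  have m := mono 0 y z T00; have bl := blip 0 y z T00.
  have bM : `|b 0 y - b 0 z| <= K' * (1 + M `^ l + M `^ l) * `|y - z|.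
    apply: (le_trans bl); rewrite ler_wpM2r// ler_wpM2l ?(ltW K'0)//.
    by rewrite lerD ?lerD ?pow_le ?(ltW l0).
  rewrite -(@ler_pXn2r _ 2)// ?nnegrE ?mulr_ge0 ?sqrtr_ge0//.
  rewrite exprMn sqr_sqrtr//.
  set S := `|sigma y - sigma z| ^+ 2 in m *.
  have S0 : 0 <= S by rewrite sqr_ge0.
  have c1 : - ((y - z) * (b 0 y - b 0 z)) <= `|y - z| * `|b 0 y - b 0 z|.
    by rewrite -normrM -normrN ler_norm.
  have c2 : `|y - z| * `|b 0 y - b 0 z| <=
      K' * (1 + M `^ l + M `^ l) * `|y - z| ^+ 2.
    have := ler_wpM2l (normr_ge0 (y - z)) bM; rewrite expr2; lra.
  have c3 : S <= (p1 - 1) * S by rewrite ler_peMl//; move: p12; lra.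
  rewrite /L2 mulrDl -!mulrA; move: m c1 c2 c3; rewrite -!mulrA.
  set x1 := (y - z) * _; set x2 := K' * _; set x3 := _ * S; set x4 := K * _.
  by lra.
pose L := Num.sqrt L2.
have L0 : 0 <= L by exact: sqrtr_ge0.
have B0 : 0 <= K' * (1 + M `^ (l + 1)).
  by rewrite mulr_ge0 ?(ltW K'0)// addr_ge0// powR_ge0.
have S0 : 0 <= `|sigma 0| + L * M by rewrite addr_ge0// mulr_ge0.
exists (1 + L + K' * (1 + M `^ (l + 1)) + (`|sigma 0| + L * M)); split.
- by move: L0 B0 S0; lra.
- move=> r y rT yM; apply: (le_trans (bgrow r y rT)).
  have : K' * (1 + `|y| `^ (l + 1)) <= K' * (1 + M `^ (l + 1)).
    by rewrite ler_pM2l// lerD2l pow_le// addr_ge0// ltW.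
  by move: L0 S0; lra.
- move=> y yM; have := lip y 0 yM; rewrite normr0 subr0 => /(_ M0) h.
  have h2 : L * `|y| <= L * M by rewrite ler_wpM2l.
  have := ler_normD (sigma y - sigma 0) (sigma 0); rewrite subrK.
  by move: h h2 L0 B0; rewrite -/L; lra.
- move=> y z yM zM; apply: (le_trans (lip y z yM zM)).
  by rewrite ler_wpM2r// -/L; move: B0 S0; lra.
Qed.

Section cutoff.
Context {R : realType}.
Implicit Types (sigma : R -> R) (delta M : R).

(** Minimum and maximum preserve the local Lipschitz property of [sigma]. As [delta] tends to 0 and
    [M] to infinity, the sets of positivity exhaust the set where [sigma] does not vanish. *)
Definition cutoff sigma delta M (y : R) : R :=
  Num.max 0 (Num.min (`|sigma y| - delta) (M - `|y|)).

Lemma cutoff_itv sigma delta M y : 0 <= M -> 0 <= cutoff sigma delta M y <= M.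
Proof.
move=> M0; rewrite /cutoff le_max lexx/= ge_max M0/= ge_min; apply/orP; right.
by rewrite gerBl.
Qed.

Lemma cutoff_gt0 sigma delta M y :
  (0 < cutoff sigma delta M y) = (delta < `|sigma y|) && (`|y| < M).
Proof. by rewrite /cutoff lt_max ltxx/= lt_min !subr_gt0. Qed.

Lemma measurable_cutoff sigma delta M : measurable_fun [set: R] sigma ->
  measurable_fun [set: R] (cutoff sigma delta M).
Proof.
move=> ms; apply: measurable_maxr => //; apply: measurable_minr.
  by apply: measurable_funB => //; exact: measurableT_comp.
by apply: measurable_funB.
Qed.

Lemma cutoff_lip sigma delta M C y z : 0 <= C ->
  `|sigma y - sigma z| <= C * `|y - z| ->
  `|cutoff sigma delta M y - cutoff sigma delta M z| <= (1 + C) * `|y - z|.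
Proof.
move=> C0; have max_min_le (u u' v v' c : R) : 0 <= c -> u <= u' + c -> v <= v'
  + c ->
    Num.max 0 (Num.min u v) <= Num.max 0 (Num.min u' v') + c.
  move=> c0 uu vv; rewrite ge_max addr_ge0 ?le_max ?lexx//=.
  apply: (@le_trans _ _ (Num.min u' v' + c)); last first.
    by rewrite lerD2r le_max lexx orbT.
  by rewrite addr_minl le_min !ge_min uu vv orbT.
have one (y1 z1 : R) : `|sigma y1 - sigma z1| <= C * `|y1 - z1| ->
    cutoff sigma delta M y1 <= cutoff sigma delta M z1 + (1 + C) * `|y1 - z1|.
  move=> sl; have d0 : 0 <= `|y1 - z1| by [].
  have Cd : 0 <= C * `|y1 - z1| by rewrite mulr_ge0.
  have e1 := ler_dist_dist (sigma y1) (sigma z1).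
  have e2 := ler_dist_dist y1 z1.
  apply: max_min_le; first by rewrite mulr_ge0// addr_ge0.
  - by move: e1 => /(le_trans (ler_norm _)); lra.
  - by move: e2; rewrite (distrC `|y1| `|z1|) => /(le_trans (ler_norm _)); lra.
move=> sl; have h1 := one y z sl; have := one z y.
rewrite (distrC (sigma z)) (distrC z) => /(_ sl) h2.
by rewrite ler_norml; lra.
Qed.

End cutoff.

Theorem theorem4p3 (R : realType) (T : R) (b : R -> R -> R) (sigma : R -> R)
  (T_gt0 : 0 < T)
  (b_meas : measurable_fun (`[0, T] `*` [set: R]) (fun p : R * R => b p.1 p.2))
  (sigma_meas : measurable_fun [set: R] sigma)
  (K p0 p1 : R) (K_gt0 : 0 < K) (p0_gt2 : 2 < p0) (p1_gt2 : 2 < p1)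
  (coercive : forall s x : R, 0 <= s <= T ->
     2 * x * b s x + (p0 - 1) * `|sigma x| ^+ 2 <= K * (1 + `|x| ^+ 2))
  (monotone : forall s x y : R, 0 <= s <= T ->
     2 * (x - y) * (b s x - b s y) + (p1 - 1) * `|sigma x - sigma y| ^+ 2
       <= K * `|x - y| ^+ 2)
  (K' l : R) (K'_gt0 : 0 < K') (l_gt0 : 0 < l) (l_le : l <= (p0 - 2) / 4)
  (b_lipschitz : forall s x y : R, 0 <= s <= T ->
     `|b s x - b s y| <= K' * (1 + `|x| `^ l + `|y| `^ l) * `|x - y|)
  (b_growth : forall s x : R, 0 <= s <= T ->
     `|b s x| <= K' * (1 + `|x| `^ (l + 1)))
  (d : measure_display) (Omega : measurableType d) (P : probability Omega R)
  (F : R -> set (set Omega)) (W : R -> Omega -> R)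
  (F_filtration : filtration T F) (W_brownian : brownian_motion P T F W)
  (x : R) (X : R -> Omega -> R)
  (X_solution : sde_solution P T F W b sigma x X)
  (t : R) (t_gt0 : 0 < t) (t_le : t <= T) :
  admits_density_on P (X t) [set y : R | sigma y != 0].
Proof.
have T0 : 0 <= T by exact: ltW.
apply/null_content_dominatesP => A mA A0.
have tT' : 0 <= t <= T by rewrite ltW.
have mXt := measurable_solution F_filtration X_solution tT'.
have mS : measurable [set y : R | sigma y != 0].
  have := sigma_meas measurableT _ (measurableC (measurable_set1 (0 : R))).
  rewrite setTI; congr measurable; apply/seteqP; split => y /=; by move/eqP.
pose E := X t @^-1` (A `&` [set y : R | sigma y != 0]).
have mE : measurable E.
  by rewrite /E -[X in measurable X]setTI; apply: mXt => //; exact: measurableI.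
rewrite /pushforward -/E; apply/(negligibleP P mE).
(* With localisation radius [n + 1], the support in the ball of radius [n] leaves the required
   margin 1. Countably many weights suffice, so their exceptional null sets can be united. *)
pose psi (n : nat) := cutoff sigma n.+1%:R^-1 n%:R.
have zero n : {ae P, forall w, weight X (n%:R + 1) (psi n) t w * \1_A (X t w) =
  0}.
  have M0 : 0 <= n%:R + 1 + 1 :> R by rewrite !addr_ge0.
  have [C [C0 b_le sig_le sig_lip]] := local_bounds T0 K_gt0 p1_gt2 monotone
    K'_gt0 l_gt0 b_lipschitz b_growth M0.
  have mpsi : measurable_fun [set: R] (psi n) by exact: measurable_cutoff.
  have psi_itv y : 0 <= psi n y <= n%:R by exact: cutoff_itv.
  have d0 : 0 < n.+1%:R^-1 :> R by rewrite invr_gt0 ltr0n.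
  have psi_supp y : psi n y != 0 -> `|y| <= n%:R + 1 - 1 /\ n.+1%:R^-1 <=
    `|sigma y|.
    move=> py0; have : 0 < psi n y.
      by rewrite lt_neqAle eq_sym py0; case/andP: (psi_itv y).
    by rewrite cutoff_gt0 addrK => /andP[/ltW ? /ltW ?].
  have C1 : 0 <= 1 + C by rewrite addr_ge0// ltW.
  have psi_lip y z : `|y| <= n%:R + 1 + 1 -> `|z| <= n%:R + 1 + 1 ->
      `|psi n y - psi n z| <= (1 + C) * `|y - z|.
    by move=> yN zN; apply: cutoff_lip; [exact: ltW|exact: sig_lip].
  have I0 := expectation_weight_null F_filtration W_brownian X_solution
    sigma_meas C0 b_le sig_le sig_lip mpsi d0 psi_itv psi_supp C1 psi_lip
    t_gt0 t_le mA A0.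
  have mf : measurable_fun [set: Omega]
      (fun w => (weight X (n%:R + 1) (psi n) t w * \1_A (X t w))%:E : \bar R).
    apply/measurable_EFinP; apply: measurable_funM.
      exact: (measurable_weight F_filtration X_solution).
    by apply: (measurableT_comp _ mXt); exact: measurable_indic.
  have f0 w : 0 <= weight X (n%:R + 1) (psi n) t w * \1_A (X t w).
    by rewrite mulr_ge0//; case/andP: (weight_itv X (n%:R + 1) psi_itv t w).
  have := (ae_eq_integral_abs P measurableT mf).1.
  under eq_integral do rewrite gee0_abs ?lee_fin//.
  move=> /(_ I0); apply: filterS => w /(_ Logic.I) [].
  by [].
have cX : {ae P, forall w, {within `[0, T], continuous (fun r => X r w)}}.
  by case: X_solution.
have nE : {ae P, forall w, ~ E w}.
  apply: filterS2 (ae_foralln zero) cX => w {}zero cw [AX /= sX].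
  have [M HM] := continuous_path_bounded T0 cw.
  have s0 : 0 < `|sigma (X t w)| by rewrite normr_gt0.
  have M0 : 0 <= M by apply: le_trans (HM 0 _); rewrite // lexx.
  (* Any [n] above this sum exceeds both the bound of the path and [1 / |sigma (X t w)|], so the
     [n]-th weight is positive at [w], contradicting its vanishing on the event. *)
  have z0 : 0 <= M + `|sigma (X t w)|^-1 by rewrite addr_ge0.
  have := archi_boundP z0; set n := Num.bound _ => hn.
  have Mn : M < n%:R by apply: le_lt_trans hn; rewrite lerDl.
  have := zero n; rewrite /weight !indicE mem_set; last first.
    move=> q /andP[q0 qt]; rewrite (le_trans (HM _ _)) ?q0 ?(le_trans qt)//.
    by rewrite (le_trans (ltW Mn))// lerDl.
  rewrite mem_set// !mulr1; apply/eqP/lt0r_neq0; rewrite cutoff_gt0.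
  rewrite (le_lt_trans (HM t tT') Mn) andbT.
  rewrite -[ltRHS]invrK ltf_pV2 ?posrE ?ltr0n ?invr_gt0//.
  have : `|sigma (X t w)|^-1 < n%:R by apply: le_lt_trans hn; rewrite lerDr.
  by move=> /lt_trans; apply; rewrite ltr_nat.
apply: negligibleS nE => w Ew /=; exact.
Qed.
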